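(* Let $n\ge 1$, let $H$ be an $n$-stepsize matrix, and let $\lambda=\{\lambda_{ij}\ge 0: i\in\{0,1,\dots,n,*\},\ j\in\{0,1,\dots,n\}\}$, $\gamma=[\gamma_0,\dots,\gamma_n]\in\mathbb{R}^{n+1}$ and $R_n>0$ be such that, for the first-order method with $H$ (unconstrained setting) and its co-coercivities $Q_{ij}$, the identity $$\sum_{i,j}\lambda_{ij}Q_{ij}+\frac12\Big\|x_0-x_*-\sum_{i=0}^n\gamma_i g_i\Big\|^2=R_n(f_*-f_n)+\frac12\|x_0-x_*\|^2$$ holds. Let $\xi\in\mathbb{R}$, and define $\mu=\{\mu_{ij}: i\in\{1,\dots,n,*\}, j\in\{1,\dots,n\}\}$, $\sigma$, $v$, $L$, $S$ by the explicit formulas given in the context. Then for the composite extension with $H$ and its co-coercivities $Q^f_{ij},Q^h_{ij}$, the identity $$\sum_{i,j}\lambda_{ij}Q^f_{ij}+\sum_{i,j}\mu_{ij}Q^h_{ij}+\frac12\|x_0-x_*-u\|^2+\frac12\mathrm{Tr}(VSV^T)=R_n(F_*-F_n)+\frac12(1+\xi)\|x_0-x_*\|^2$$ holds, where $F_i=f_i+h_i$, $V=[\,x_0-x_*\,|\,s_1\,|\,\cdots\,|\,s_n\,|\,s_*\,]$ (columns), $u=\sum_{i=0}^{n-1}\gamma_i(g_i+s_{i+1})+\gamma_n g_n+\sum_{i\in\{1,\dots,n,*\}}\sigma_i s_i$, and $S=\begin{bmatrix}\xi & v^T\\ v & L\end{bmatrix}$; moreover the entries of $v$ sum to $0$ and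 $L$ is Laplacian (symmetric, all off-diagonal entries nonpositive, all row sums zero). In particular, suppose that (i) $\mu_{ij}\ge 0$ for all $i\neq j$, and (ii) $S$ is positive semidefinite (this is implied, for example, if $\xi=v^TL^\dagger v$, with $L^\dagger$ the Moore–Penrose pseudoinverse). Then for every convex $1$-smooth $f:\mathbb{R}^d\to\mathbb{R}$, every convex $h:\mathbb{R}^d\to\mathbb{R}\cup\{+\infty\}$, every minimizer $x_*$ of $F=f+h$, and all iterates $x_0,\dots,x_n$ of the composite extension with $H$, $$F(x_n)-F(x_* )\le\frac{1+\xi}{2R_n}\|x_0-x_*\|^2 .$$
   Context: Stepsize matrix: an $n$-stepsize matrix $H$ is a real upper triangular $n\times n$ matrix whose entry in row $j+1$, column $i$ is $\alpha_{i,j}$ ($0\le j<i\le n$), with $\alpha_{k,k-1}\ne0$ for $1\le k\le n$. First-order method with $H$ (unconstrained setting): $x_k=x_{k-1}-\sum_{j=0}^{k-1}\alpha_{k,j}g_j$, $k=1,\dots,n$, where $g_i=\nabla f(x_i)$, $f_i=f(x_i)$ for $i\in\{0,\dots,n,*\}$ and $g_*=0$. Composite extension with $H$: $x_k=x_{k-1}-\sum_{j=0}^{k-1}\alpha_{k,j}(g_j+s_{j+1})$, $k=1,\dots,n$, where $g_i=\nabla f(x_i)$, $f_i=f(x_i)$, $h_i=h(x_i)$, and $s_i\in\partial h(x_i)$ for $1\le i\le n$. At the optimum, $g_*=\nabla f(x_* )$ and $s_*=-g_*\in\partial h(x_* )$. Co-coercivities: in the unconstrained setting $Q_{ij}=f_i-f_j-\langle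 g_j,x_i-x_j\rangle-\frac12\|g_i-g_j\|^2$, with the iterates of the first-order method. In the composite setting $Q^f_{ij}=f_i-f_j-\langle g_j,x_i-x_j\rangle-\frac12\|g_i-g_j\|^2$ and $Q^h_{ij}=h_i-h_j-\langle s_j,x_i-x_j\rangle$, with the iterates of the composite extension. Identities: they are algebraic identities, i.e. they hold for all values of the free variables, where $x_1,\dots,x_n$ are given by the recursions above. Unconstrained free variables: $f_0,\dots,f_n,f_*\in\mathbb{R}$ and $x_0,x_*,g_0,\dots,g_n\in\mathbb{R}^d$ (with $g_*=0$). Composite free variables: $f_0,\dots,f_n,f_*,h_1,\dots,h_n,h_*\in\mathbb{R}$ and $x_0,x_*,g_0,\dots,g_n,s_1,\dots,s_n,s_*\in\mathbb{R}^d$ (with $g_*=-s_*$). Here $d\ge1$ is arbitrary. Conventions: sums $\sum_{i,j}$ run over the index sets of the multipliers; diagonal multipliers are zero ($\lambda_{ii}=0$, and $\mu_{ii}$ is not used since $Q_{ii}^h=0$). $\lambda_{i,*}:=0$. $\lambda_{i,\bullet}=\sum_j\lambda_{i,j}$, $\lambda_{\bullet,j}=\sum_i\lambda_{i,j}$ (including $i=*$). Explicit formulas: - $\widetilde H=HU_n$, where $U_n$ is the $n\times n$ upper triangular matrix with all entries on and above the diagonal equal to $1$. - $\widehat\lambda\in\mathbb{R}^{n\times n}$, rows and columns indexed by $0,\dots,n-1$: off-diagonal $(i,j)$ entry $\lambda_{i,j}+\lambda_{j,i}$, diagonal entry $-(\lambda_{\bullet,i}+\lambda_{i,\bullet})$.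 - $\widetilde\lambda\in\mathbb{R}^{n\times n}$, rows indexed by $i=1,\dots,n$, columns by $j=0,\dots,n-1$: entry $\lambda_{i,j}$ if $i\ne j$ and $-\lambda_{\bullet,i}$ if $i=j$. - $\sigma=[\sigma_1,\dots,\sigma_n,\sigma_*]$ with $\sigma_i=\dfrac{\lambda_{i-1,n}+\lambda_{n,i-1}}{\gamma_n}$ for $1\le i\le n$ and $\sigma_*=\lambda_{*,n}/\gamma_n$. - $\widetilde\gamma=[\gamma_0,\dots,\gamma_{n-1}]$, $\widetilde\sigma=[\sigma_1,\dots,\sigma_n]$ (column vectors). - $\widetilde\mu=-\widetilde H^{-1}\big((\widetilde H\widetilde\lambda)^T+\widetilde\gamma(\widetilde\gamma+\widetilde\sigma)^T\big)\in\mathbb{R}^{n\times n}$. For $1\le i,j\le n$, $i\ne j$: $\mu_{ij}=\widetilde\mu_{ij}$, and $\mu_{*,j}=-\sum_{i=1}^n\widetilde\mu_{ij}$. - $v=[v_1,\dots,v_n,v_*]$ with $v_i=\sigma_i+\lambda_{*,i-1}-\mu_{*,i}$ for $1\le i\le n$ and $v_*=\sigma_*$. - $L=-\begin{bmatrix}\widehat\lambda&\widetilde\gamma\\ \widetilde\gamma^T&-\lambda_{*,\bullet}\end{bmatrix}-\sigma\sigma^T\in\mathbb{R}^{(n+1)\times(n+1)}$. *)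

(* Defs.v *)
From mathcomp Require Import all_boot all_order all_algebra.
From mathcomp Require Import all_classical all_reals all_analysis.

Set Implicit Arguments.
Unset Strict Implicit.
Unset Printing Implicit Defensive.

Import Order.TTheory GRing.Theory Num.Theory.
Import numFieldNormedType.Exports.
Local Open Scope classical_set_scope.
Local Open Scope ring_scope.

(* Index conventions.
   - {0,...,n} is 'I_n.+1 and {0,...,n,*} is option 'I_n.+1, with None for *.
   - {1,...,n} is 'I_n with k : 'I_n standing for k+1, and {1,...,n,*} is
     option 'I_n.
   - 'I_n also serves for {0,...,n-1}, as rows and columns of matrices.
   A family a_1..a_n,a_* (or a_0..a_n,a_* ) given by a : 'I_k -> T and ast : T
   is written oapp a ast : option 'I_k -> T. *)
Definition cur n (k : 'I_n) : 'I_n.+1 := widen_ord (leqnSn n) k.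
Definition nxt n (k : 'I_n) : 'I_n.+1 := lift ord0 k.

Section Euclidean.
Context {R : realType} {d : nat}.

Definition dot (u v : 'cV[R]_d) : R := (u^T *m v) 0 0.

(* The library norm on matrices is the sup norm. *)
Definition enorm (u : 'cV[R]_d) : R := Num.sqrt (dot u u).

Definition gradient (f : 'cV[R]_d -> R) (x : 'cV[R]_d) : 'cV[R]_d :=
  \col_i 'D_(delta_mx i 0) f x.

Definition smooth1 (f : 'cV[R]_d -> R) : Prop :=
  (forall x, differentiable f x) /\
  (forall x y, enorm (gradient f x - gradient f y) <= enorm (x - y)).

Definition econvex (h : 'cV[R]_d -> \bar R) : Prop :=
  forall (x y : 'cV[R]_d) (t : R), 0 <= t <= 1 ->
    (h (t *: x + (1 - t) *: y)%R <= t%:E * h x + (1 - t)%:E * h y)%E.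

(* As usual, the subdifferential is empty outside the domain of h. *)
Definition subdifferential (h : 'cV[R]_d -> \bar R) (x : 'cV[R]_d) :
    set 'cV[R]_d :=
  [set s | h x \is a fin_num /\
           forall y, (h x + (dot s (y - x))%:E <= h y)%E].

Definition objective (f : 'cV[R]_d -> R) (h : 'cV[R]_d -> \bar R)
  (x : 'cV[R]_d) : \bar R := ((f x)%:E + h x)%E.

Definition minimizer (F : 'cV[R]_d -> \bar R) (xs : 'cV[R]_d) : Prop :=
  forall y, (F xs <= F y)%E.

Definition Qf (I : Type) (f : I -> R) (g x : I -> 'cV[R]_d) (i j : I) : R :=
  f i - f j - dot (g j) (x i - x j) - 2^-1 * enorm (g i - g j) ^+ 2.

Definition Qh (I : Type) (h : I -> R) (s x : I -> 'cV[R]_d) (i j : I) : R :=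
  h i - h j - dot (s j) (x i - x j).

End Euclidean.

Section Matrices.
Context {R : realType}.

Definition psd n (M : 'M[R]_n) : Prop :=
  M^T = M /\ forall x : 'cV[R]_n, 0 <= (x^T *m M *m x) 0 0.

Definition laplacian n (M : 'M[R]_n) : Prop :=
  [/\ M^T = M,
      forall i j, i != j -> M i j <= 0 &
      forall i, \sum_j M i j = 0].

Definition moore_penrose m n (A : 'M[R]_(m, n)) (P : 'M[R]_(n, m)) : Prop :=
  [/\ A *m P *m A = A, P *m A *m P = P,
      (A *m P)^T = A *m P & (P *m A)^T = P *m A].

Definition mp_inv m n (A : 'M[R]_(m, n)) : 'M[R]_(n, m) :=
  xget 0 [set P | moore_penrose A P].

Lemma gram_unit m n (B : 'M[R]_(m, n)) : row_free B -> B *m B^T \in unitmx.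
Proof.
move=> fB; rewrite -row_free_unit; apply/row_freeP.
suff : row_free (B *m B^T) by move/row_freeP.
rewrite -kermx_eq0; apply/eqP/row_matrixP => i; rewrite row0.
set u := row i _.
have uB : u *m (B *m B^T) = 0 by rewrite /u -row_mul mulmx_ker row0.
have uBB : (u *m B) *m (u *m B)^T = 0.
  by rewrite trmx_mul mulmxA -(mulmxA u) uB mul0mx.
have uB0 : u *m B = 0.
  have := congr1 (fun M : 'M[R]_1 => M 0 0) uBB; rewrite !mxE => /eqP.
  rewrite psumr_eq0; last by move=> j _; rewrite [_^T _ _]mxE -expr2 sqr_ge0.
  move/allP => uB0; apply/rowP => j; have := uB0 j (mem_index_enum j).
  by rewrite [_^T _ _]mxE -expr2 sqrf_eq0 => /eqP ->; rewrite mxE.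
by apply: (row_free_inj fB); rewrite uB0 mul0mx.
Qed.

Lemma moore_penrose_mul m n r (C : 'M[R]_(m, r)) (B : 'M[R]_(r, n)) :
  row_full C -> row_free B ->
  moore_penrose (C *m B)
    (B^T *m invmx (B *m B^T) *m (invmx (C^T *m C) *m C^T)).
Proof.
move=> fC fB; have uB := gram_unit fB.
have uC : C^T *m C \in unitmx.
  rewrite -[X in _ *m X]trmxK; apply: gram_unit.
  by move: fC; rewrite /row_full /row_free mxrank_tr.
set GB := invmx (B *m B^T); set GC := invmx (C^T *m C).
have BG : B *m B^T *m GB = 1%:M by rewrite mulmxV.
have GCC : GC *m (C^T *m C) = 1%:M by rewrite mulVmx.
have GBT : GB^T = GB by rewrite /GB trmx_inv trmx_mul trmxK.
have GCT : GC^T = GC by rewrite /GC trmx_inv trmx_mul trmxK.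
set P := B^T *m GB *m (GC *m C^T).
have APE : C *m B *m P = C *m GC *m C^T.
  have -> : C *m B *m P = C *m (B *m B^T *m GB) *m (GC *m C^T).
    by rewrite /P !mulmxA.
  by rewrite BG mulmx1 mulmxA.
have PAE : P *m (C *m B) = B^T *m GB *m B.
  have -> : P *m (C *m B) = B^T *m GB *m (GC *m (C^T *m C)) *m B.
    by rewrite /P !mulmxA.
  by rewrite GCC mulmx1.
split.
- rewrite APE.
  have -> : C *m GC *m C^T *m (C *m B) = C *m (GC *m (C^T *m C)) *m B.
    by rewrite !mulmxA.
  by rewrite GCC mulmx1.
- rewrite PAE.
  have -> : B^T *m GB *m B *m P = B^T *m GB *m (B *m B^T *m GB) *m (GC *m C^T).
    by rewrite /P !mulmxA.
  by rewrite BG mulmx1.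
- by rewrite APE !trmx_mul trmxK GCT mulmxA.
- by rewrite PAE !trmx_mul trmxK GBT mulmxA.
Qed.

Lemma mp_invP m n (A : 'M[R]_(m, n)) : moore_penrose A (mp_inv A).
Proof.
rewrite /mp_inv; apply: (@xgetPex _ 0 [set P | moore_penrose A P]).
rewrite -[A]mulmx_base; eexists; apply: moore_penrose_mul.
  exact: col_base_full.
exact: row_base_free.
Qed.

(* The column vector [a_1, ..., a_n, a_* ]. *)
Definition star_col n (a : option 'I_n -> R) : 'cV[R]_(n + 1) :=
  col_mx (\col_k a (Some k)) (a None)%:M.

End Matrices.

Section Methods.
Context {R : realType} {n : nat}.

(* H j k (0-based) is alpha_{k+1,j}, so the recursions below sum over j <= k. *)
Definition stepsize_matrix (H : 'M[R]_n) : Prop :=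
  (forall j k : 'I_n, (k < j)%N -> H j k = 0) /\ (forall k, H k k != 0).

Definition first_order_method d (H : 'M[R]_n) (x g : 'I_n.+1 -> 'cV[R]_d) :
    Prop :=
  forall k : 'I_n,
    x (nxt k) = x (cur k) - \sum_(j < n | (j <= k)%N) H j k *: g (cur j).

Definition composite_method d (H : 'M[R]_n) (x g : 'I_n.+1 -> 'cV[R]_d)
    (s : 'I_n -> 'cV[R]_d) : Prop :=
  forall k : 'I_n,
    x (nxt k) =
    x (cur k) - \sum_(j < n | (j <= k)%N) H j k *: (g (cur j) + s j).

Variables (H : 'M[R]_n) (lam : option 'I_n.+1 -> 'I_n.+1 -> R)
  (gam : 'I_n.+1 -> R).

(* lambda_{.,j} and lambda_{i,.}; the latter has no term at * since
   lambda_{i,*} = 0. *)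
Definition lam_in (j : 'I_n.+1) : R := \sum_i lam i j.
Definition lam_out (i : option 'I_n.+1) : R := \sum_j lam i j.

Definition Htilde : 'M[R]_n := H *m \matrix_(i, j) ((i <= j)%N)%:R.

Definition lam_hat : 'M[R]_n :=
  \matrix_(i, j) if i == j then - (lam_in (cur i) + lam_out (Some (cur i)))
    else lam (Some (cur i)) (cur j) + lam (Some (cur j)) (cur i).

(* Row i of the matrix has index i+1, column j has index j. *)
Definition lam_tilde : 'M[R]_n :=
  \matrix_(i, j) if nxt i == cur j then - lam_in (cur j)
    else lam (Some (nxt i)) (cur j).

Definition sigma (i : option 'I_n) : R :=
  match i with
  | Some k => (lam (Some (cur k)) ord_max + lam (Some ord_max) (cur k))
              / gam ord_max
  | None => lam None ord_max / gam ord_max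
  end.

Definition gam_tilde : 'cV[R]_n := \col_k gam (cur k).
Definition sigma_tilde : 'cV[R]_n := \col_k sigma (Some k).

Definition mu_tilde : 'M[R]_n :=
  - (invmx Htilde *m
     ((Htilde *m lam_tilde)^T + gam_tilde *m (gam_tilde + sigma_tilde)^T)).

Definition mu (i : option 'I_n) (j : 'I_n) : R :=
  match i with
  | Some k => if k == j then 0 else mu_tilde k j
  | None => - \sum_k mu_tilde k j
  end.

Definition vv (i : option 'I_n) : R :=
  match i with
  | Some k => sigma (Some k) + lam None (cur k) - mu None k
  | None => sigma None
  end.

Definition Lmat : 'M[R]_(n + 1) :=
  - block_mx lam_hat gam_tilde gam_tilde^T (- lam_out None)%:M
  - star_col sigma *m (star_col sigma)^T.

Definition Smat (xi : R) : 'M[R]_(1 + (n + 1)) :=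
  block_mx xi%:M (star_col vv)^T (star_col vv) Lmat.

End Methods.

Definition unconstrained_identity (R : realType) (d n : nat) (H : 'M[R]_n)
    (lam : option 'I_n.+1 -> 'I_n.+1 -> R) (gam : 'I_n.+1 -> R) (Rn : R) :
    Prop :=
  forall (f : 'I_n.+1 -> R) (fs : R)
    (x g : 'I_n.+1 -> 'cV[R]_d) (xs : 'cV[R]_d),
  first_order_method H x g ->
  \sum_i \sum_j lam i j * Qf (oapp f fs) (oapp g 0) (oapp x xs) i (Some j)
  + 2^-1 * enorm (x ord0 - xs - \sum_i gam i *: g i) ^+ 2
  = Rn * (fs - f ord_max) + 2^-1 * enorm (x ord0 - xs) ^+ 2.

(* The number of steps is n = m.+1, so that h_n is h ord_max. *)
Definition composite_identity (R : realType) (d m : nat) (H : 'M[R]_m.+1)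
    (lam : option 'I_m.+2 -> 'I_m.+2 -> R) (gam : 'I_m.+2 -> R) (Rn xi : R) :
    Prop :=
  forall (f : 'I_m.+2 -> R) (fs : R) (h : 'I_m.+1 -> R) (hs : R)
    (x g : 'I_m.+2 -> 'cV[R]_d) (xs : 'cV[R]_d)
    (s : 'I_m.+1 -> 'cV[R]_d) (ss : 'cV[R]_d),
  composite_method H x g s ->
  let u := \sum_i gam (cur i) *: (g (cur i) + s i)
           + gam ord_max *: g ord_max
           + \sum_i sigma lam gam i *: oapp s ss i in
  let V : 'M[R]_(d, 1 + (m.+1 + 1)) :=
    row_mx (x ord0 - xs) (row_mx (\matrix_(r, k) s k r 0) ss) in
  \sum_i \sum_j lam i j * Qf (oapp f fs) (oapp g (- ss)) (oapp x xs) i (Some j)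
  + \sum_i \sum_j mu H lam gam i j
      * Qh (oapp h hs) (oapp s ss) (oapp (fun k => x (nxt k)) xs) i (Some j)
  + 2^-1 * enorm (x ord0 - xs - u) ^+ 2
  + 2^-1 * \tr (V *m Smat H lam gam xi *m V^T)
  = Rn * ((fs + hs) - (f ord_max + h ord_max))
    + 2^-1 * (1 + xi) * enorm (x ord0 - xs) ^+ 2.

(* Main.v *)
Require Import Defs.
From mathcomp Require Import all_boot all_order all_algebra.
From mathcomp Require Import all_classical all_reals all_analysis.
From mathcomp Require Import ring lra.

Set Implicit Arguments.
Unset Strict Implicit.
Unset Printing Implicit Defensive.

Import Order.TTheory GRing.Theory Num.Theory.
Import numFieldNormedType.Exports.
Local Open Scope classical_set_scope.
Local Open Scope ring_scope.

(** Both identities are sums over coordinates of scalar ones, and comparing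
    coefficients in the scalar hypothesis gives: lambda_{*,j} = gamma_j; the net
    lambda-flow out of j is R_n for j = *, - R_n for j = n and 0 otherwise; and
    a polarized quadratic relation in the gradients ([lam_polar]).

    Substitute G_i = g_i + s_{i+1} (i < n) and G_n = g_n + t in the hypothesis,
    where gamma_n t = \sum_i sigma_i s_i. The error is the pairing of G with
    c = (s_1, ..., s_n, t, s_* ), plus the Dirichlet energy of c for the weights
    lambda. By [lam_polar] the pairing involves only G_0, ..., G_{n-1}, through
    \tilde H \tilde mu s, and this is what the terms in mu cancel. The energy of
    c is the quadratic form of L: passing from c to s eliminates the vertex n
    from the graph Laplacian (a Schur complement).

    If L a = 0, then c is constant along the edges of positive weight, so that
    [lam_polar] gives \tilde mu a = 0 (once a_* = 0) and v is orthogonal to a.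
    Hence v lies in the range of L, and xi = v^T L^+ v makes S semidefinite. *)

(** * Sums and induction over the index sets *)

Lemma sum_option (V : zmodType) (T : finType) (F : option T -> V) :
  \sum_i F i = F None + \sum_i F (Some i).
Proof.
rewrite (bigD1 None) //=; congr (_ + _).
rewrite (reindex_omap Some id) /=; last by case.
by apply: eq_bigl => i; rewrite eqxx.
Qed.

Lemma sum_cur (V : zmodType) n (F : 'I_n.+1 -> V) :
  \sum_i F i = \sum_i F (cur i) + F ord_max.
Proof. exact: big_ord_recr. Qed.

Lemma ord_nxt_ind n (P : 'I_n.+1 -> Prop) :
  P ord0 -> (forall k, P (cur k) -> P (nxt k)) -> forall i, P i.
Proof.
move=> P0 PS [i]; elim: i => [|i IH] lt_i.
  by rewrite (_ : Ordinal lt_i = ord0) //; apply: val_inj.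
have := PS (Ordinal (lt_i : (i < n)%N)).
rewrite (_ : nxt _ = Ordinal lt_i); last exact: val_inj.
apply; rewrite (_ : cur _ = Ordinal (ltnW lt_i)); last exact: val_inj.
exact: IH.
Qed.

Lemma cur_neq_max n (k : 'I_n) : (cur k == ord_max) = false.
Proof.
by apply/eqP => /(congr1 val) /= E; move: (ltn_ord k); rewrite E ltnn.
Qed.

(** * Scalar iterates as linear functions of the gradients *)

Section Scalar.
Context {R : realType} {n : nat}.
Variables (H : 'M[R]_n).
Implicit Types (g : 'I_n.+1 -> R).

(* x_0 - x_i, for d = 1. *)
Definition displacement g (i : 'I_n.+1) : R :=
  \sum_(k < n | (k < i)%N) \sum_(j < n | (j <= k)%N) H j k * g (cur j).

Lemma displacement0 g : displacement g ord0 = 0.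
Proof. by rewrite /displacement big_pred0. Qed.

Lemma displacement_nxt g k : displacement g (nxt k) =
  displacement g (cur k) + \sum_(j < n | (j <= k)%N) H j k * g (cur j).
Proof.
rewrite /displacement (bigD1 k) //= addrC; congr (_ + _).
by apply: eq_bigl => i; rewrite /bump leq0n add1n ltnS [RHS]ltn_neqAle andbC.
Qed.

Lemma displacement_eq g (x : 'I_n.+1 -> R) :
  (forall k, x (nxt k) =
     x (cur k) - \sum_(j < n | (j <= k)%N) H j k * g (cur j)) ->
  forall i, x i = x ord0 - displacement g i.
Proof.
move=> rec; apply: ord_nxt_ind; first by rewrite displacement0 subr0.
by move=> k IH; rewrite rec IH displacement_nxt opprD addrA.
Qed.

Lemma displacementD g g' i : displacement (fun j => g j + g' j) i =
  displacement g i + displacement g' i.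
Proof.
rewrite -big_split; apply: eq_bigr => k _.
by rewrite -big_split; apply: eq_bigr => j _; rewrite mulrDr.
Qed.

Lemma displacement_const0 g i :
  (forall k, g (cur k) = 0) -> displacement g i = 0.
Proof.
by move=> g0; rewrite /displacement big1 // => k _; rewrite big1 // => j _;
   rewrite g0 mulr0.
Qed.

Hypothesis hH : stepsize_matrix H.

(** After exchanging the sums, g_l has the coefficient \sum_{k <= p} H l k, an entry of H U_n; the
    restriction l <= k is automatic as H is upper triangular. *)
Lemma displacement_Htilde g p :
  displacement g (nxt p) = \sum_l g (cur l) * Htilde H l p.
Proof.
under [RHS]eq_bigr do rewrite mxE mulr_sumr.
rewrite exchange_big /= /displacement big_mkcond; apply: eq_bigr => k _.
rewrite /= /bump leq0n add1n ltnS.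
under [RHS]eq_bigr do rewrite mxE.
case: ifP => _; last by rewrite big1 // => l _; rewrite !mulr0.
rewrite big_mkcond; apply: eq_bigr => l _.
case: leqP => [_|lt_kl]; first by rewrite mulr1 mulrC.
by rewrite hH.1 // mul0r mulr0.
Qed.

Lemma Htilde_unit : Htilde H \in unitmx.
Proof.
(* [det_trig] is about lower triangular matrices, hence the transposes. *)
rewrite unitmx_mul; apply/andP; split; rewrite unitmxE -det_tr det_trig.
- by rewrite unitfE prodf_seq_neq0; apply/allP => i _; rewrite mxE hH.2.
- by apply/is_trig_mxP => i j lt_ij; rewrite mxE hH.1.
- by under eq_bigr do rewrite !mxE leqnn; rewrite big1 // unitr1.
- by apply/is_trig_mxP => i j lt_ij; rewrite !mxE leqNgt lt_ij.
Qed.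

End Scalar.

(** * Coefficient comparison in the scalar identity *)

Section Multipliers.
Context {R : realType} {n : nat}.
Variables (H : 'M[R]_n) (lam : option 'I_n.+1 -> 'I_n.+1 -> R).
Variables (gam : 'I_n.+1 -> R) (Rn : R).

Definition lam_sum (phi : option 'I_n.+1 -> 'I_n.+1 -> R) : R :=
  \sum_i \sum_j lam i j * phi i j.

Lemma lam_sumD phi psi :
  lam_sum phi + lam_sum psi = lam_sum (fun i j => phi i j + psi i j).
Proof.
rewrite -big_split; apply: eq_bigr => i _; rewrite -big_split.
by apply: eq_bigr => j _; rewrite mulrDr.
Qed.

Lemma lam_sumZ a phi : a * lam_sum phi = lam_sum (fun i j => a * phi i j).
Proof.
rewrite mulr_sumr; apply: eq_bigr => i _; rewrite mulr_sumr.
by apply: eq_bigr => j _; rewrite mulrCA.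
Qed.

Lemma lam_sumN phi : - lam_sum phi = lam_sum (fun i j => - phi i j).
Proof.
rewrite -mulN1r lam_sumZ; apply: eq_bigr => i _.
by apply: eq_bigr => j _; rewrite mulN1r.
Qed.

Lemma eq_lam_sum phi psi : (forall i j, phi i j = psi i j) ->
  lam_sum phi = lam_sum psi.
Proof.
by move=> E; apply: eq_bigr => i _; apply: eq_bigr => j _; rewrite E.
Qed.

Lemma lam_sumE phi : lam_sum phi = \sum_j lam None j * phi None j
  + \sum_i \sum_j lam (Some i) j * phi (Some i) j.
Proof. exact: sum_option. Qed.

Lemma lam_sum_out a :
  lam_sum (fun i _ => a i) = \sum_i lam_out lam i * a i.
Proof. by apply: eq_bigr => i _; rewrite -mulr_suml. Qed.

Lemma lam_sum_in a :
  lam_sum (fun _ j => a j) = \sum_j lam_in lam j * a j.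
Proof.
by rewrite /lam_sum exchange_big; apply: eq_bigr => i _; rewrite -mulr_suml.
Qed.

(** The polarized energy of the graph on {0, ..., n, *} with edge weights lambda_{ij}. *)
Definition dirichlet (a b : option 'I_n.+1 -> R) : R :=
  lam_sum (fun i j => (a i - a (Some j)) * (b i - b (Some j))).

(** The total factor of g_j in the terms - g_j (x_i - x_j) when x_* = x_0; the default 0 is then the
    displacement of x_*. *)
Definition drift g j : R :=
  \sum_i lam i j * (oapp (displacement H g) 0 i - displacement H g j).

Definition gam_sum g : R := \sum_i gam i * g i.

Definition ext g : option 'I_n.+1 -> R := oapp g 0.

Lemma lam_sum_drift b g :
  lam_sum (fun i j => b j * (oapp (displacement H g) 0 i - displacement H g j))
  = \sum_j b j * drift g j.
Proof.
rewrite /lam_sum exchange_big; apply: eq_bigr => j _; rewrite mulr_sumr.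
by apply: eq_bigr => i _; rewrite mulrCA.
Qed.

(* Without loss of generality x_0 = 0, and then x_* = - w. *)
Definition scalar_identity :=
  forall (f : 'I_n.+1 -> R) fs g w,
  let F := oapp f fs in
  let X := oapp (fun i => - displacement H g i) (- w) in
  lam_sum (fun i j => F i - F (Some j) - g j * (X i - X (Some j))
                      - 2^-1 * (ext g i - ext g (Some j)) ^+ 2)
  + 2^-1 * (w - gam_sum g) ^+ 2 = Rn * (fs - f ord_max) + 2^-1 * w ^+ 2.

Hypothesis hyp : scalar_identity.

(** With zero gradients and w = 0 only function values survive. As F is arbitrary, this is later
    applied to displacements as well. *)
Lemma lam_balance (F : option 'I_n.+1 -> R) :
  lam_sum (fun i j => F i - F (Some j)) = Rn * (F None - F (Some ord_max)).
Proof.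
have := hyp (fun i => F (Some i)) (F None) (fun=> 0) 0.
rewrite /gam_sum big1 => [|i _]; last by rewrite mulr0.
rewrite subrr expr0n mulr0 !addr0 => <-; apply: eq_lam_sum => i j /=.
have E k : ext (fun=> 0) k = 0 by case: k.
have -> : oapp (fun i => F (Some i)) (F None) i = F i by case: i.
by rewrite mul0r !E; ring.
Qed.

(** The coefficient of w g_j: subtract the hypothesis at w = 0 from the one at w = 1, for g the
    indicator of j. *)
Lemma lam_star j : lam None j = gam j.
Proof.
pose g (i : 'I_n.+1) : R := (i == j)%:R.
have h0 := hyp (fun=> 0) 0 g 0; have h1 := hyp (fun=> 0) 0 g 1.
have gE a : \sum_i a i * g i = a j.
  rewrite (bigD1 j) //= /g eqxx mulr1 big1 ?addr0 // => i /negbTE ->.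
  by rewrite mulr0.
have E : lam None j = lam_sum (fun i k => g k * (i == None)%:R).
  rewrite lam_sumE [X in _ = _ + X]big1 ?addr0 => [|i _]; last first.
    by rewrite big1 // => k _; rewrite !mulr0.
  rewrite -(gE (lam None)); apply: eq_bigr => k _.
  by rewrite eqxx mulr1.
move: h0 h1; rewrite /gam_sum gE /= => h0 h1.
suff : lam_sum (fun i k => g k * (i == None)%:R) = gam j by rewrite -E.
move: h0 h1; set s0 := lam_sum _; set s1 := lam_sum _ => h0 h1.
have -> : lam_sum (fun i k => g k * (i == None)%:R) = s1 - s0.
  rewrite lam_sumN lam_sumD; apply: eq_lam_sum => i k.
  by case: i => [i|] /=; ring.
by lra.
Qed.

(** For w = 0 and zero function values the hypothesis says that a quadratic form in g vanishes
    identically. Its values at g + g', g and g' give the bilinear form. *)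
Lemma lam_polar g g' :
  \sum_j g' j * drift g j + \sum_j g j * drift g' j
  - dirichlet (ext g) (ext g') + gam_sum g * gam_sum g' = 0.
Proof.
have h1 := hyp (fun=> 0) 0 g 0; have h2 := hyp (fun=> 0) 0 g' 0.
have h3 := hyp (fun=> 0) 0 (fun i => g i + g' i) 0.
rewrite -!lam_sum_drift; move: h1 h2 h3.
have -> : gam_sum (fun i => g i + g' i) = gam_sum g + gam_sum g'.
  by rewrite -big_split; apply: eq_bigr => i _; rewrite mulrDr.
rewrite /=; set s1 := lam_sum _; set s2 := lam_sum _; set s3 := lam_sum _.
move=> h1 h2 h3.
set a1 := lam_sum _; set a2 := lam_sum _.
have E : s3 - s1 - s2 = a1 + a2 - dirichlet (ext g) (ext g').
  rewrite !(lam_sumN, lam_sumD); apply: eq_lam_sum => i j /=.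
  by case: i => [i|] /=; rewrite !displacementD /ext /=; field.
rewrite -E; lra.
Qed.

End Multipliers.

Lemma sum_delta (R : nzRingType) (T : finType) (F : T -> R) j :
  \sum_i F i * (i == j)%:R = F j.
Proof.
rewrite (bigD1 j) //= eqxx mulr1 big1 ?addr0 // => i /negbTE ->.
by rewrite mulr0.
Qed.

(** * The multipliers at the vertex n, and the matrix form of the drift *)

Section Multipliers.
Context {R : realType} {n : nat}.
Variables (H : 'M[R]_n) (lam : option 'I_n.+1 -> 'I_n.+1 -> R).
Variables (gam : 'I_n.+1 -> R) (Rn : R).
Hypothesis hH : stepsize_matrix H.
Hypothesis lam_ge0 : forall i j, 0 <= lam i j.
Hypothesis lam_diag : forall j, lam (Some j) j = 0.
Hypothesis Rn_gt0 : 0 < Rn.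
Hypothesis hyp : scalar_identity H lam gam Rn.
Local Notation lam_sum := (lam_sum lam).
Local Notation drift := (drift H lam).
Local Notation dirichlet := (dirichlet lam).
Local Notation gam_sum := (gam_sum gam).
Local Notation sigma := (sigma lam gam).
Local Notation mu_tilde := (mu_tilde H lam gam).

(** [lam_balance] regrouped by vertex. Indicator functions F then isolate the net flow at a single
    vertex. *)
Lemma lam_flow (F : option 'I_n.+1 -> R) :
  \sum_i lam_out lam i * F i - \sum_j lam_in lam j * F (Some j) =
  Rn * (F None - F (Some ord_max)).
Proof.
rewrite -(lam_balance hyp) -lam_sum_out -(lam_sum_in lam (fun j => F (Some j))).
by rewrite lam_sumN lam_sumD.
Qed.

Lemma lam_out_star : lam_out lam None = Rn.
Proof.
have := lam_flow (fun i => (i == None)%:R).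
rewrite sum_delta big1 => [|j _]; last by rewrite mulr0.
by rewrite subr0 eqxx subr0 mulr1.
Qed.

Lemma lam_out_in j :
  lam_out lam (Some j) = lam_in lam j - Rn * (j == ord_max)%:R.
Proof.
have := lam_flow (fun i => (i == Some j)%:R).
rewrite sum_delta (eq_bigr (fun i => lam_in lam i * (i == j)%:R)) //.
have -> : (Some ord_max == Some j) = (j == ord_max) by exact: eq_sym.
by rewrite sum_delta /= sub0r; lra.
Qed.

Lemma sum_gam : \sum_i gam i = Rn.
Proof.
by rewrite -lam_out_star; apply: eq_bigr => i _; rewrite (lam_star hyp).
Qed.

Lemma gam_ge0 i : 0 <= gam i. Proof. by rewrite -(lam_star hyp). Qed.

(** No iterate depends on g_n, so testing [lam_polar] against this indicator isolates the
    multipliers at n. *)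
Let delta_max (i : 'I_n.+1) : R := (i == ord_max)%:R.

(** Pairing with an indicator gives the graph Laplacian of a at that vertex: degree times value,
    minus the weighted sum over the neighbours. *)
Lemma dirichlet_delta_max a : dirichlet a (ext delta_max) =
  (lam_in lam ord_max + lam_out lam (Some ord_max)) * a (Some ord_max)
  - (\sum_k (lam (Some (cur k)) ord_max + lam (Some ord_max) (cur k))
       * a (Some (cur k)) + gam ord_max * a None).
Proof.
have extE i : ext delta_max i = (i == Some ord_max)%:R by case: i.
have -> : dirichlet a (ext delta_max) =
    lam_sum (fun i j => (a i - a (Some j)) * (i == Some ord_max)%:R)
    - lam_sum (fun i j => (a i - a (Some j)) * (j == ord_max)%:R).
  rewrite lam_sumN lam_sumD; apply: eq_lam_sum => i j.
  by rewrite !extE mulrBr.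
rewrite /lam_sum exchange_big /=.
under eq_bigr => j _.
  under eq_bigr do rewrite mulrA.
  rewrite sum_delta; over.
under [X in _ - X]eq_bigr => i _.
  under eq_bigr do rewrite mulrA.
  rewrite sum_delta; over.
rewrite /= [X in _ - X]sum_option !sum_cur lam_diag mul0r addr0.
rewrite /lam_in /lam_out sum_option !sum_cur lam_diag addr0 (lam_star hyp).
under [X in X - _ = _]eq_bigr do rewrite mulrBr.
under [X in _ - (_ + X) = _]eq_bigr do rewrite mulrBr.
under [X in _ = _ - (X + _)]eq_bigr do rewrite mulrDl.
by rewrite !sumrB big_split /= -!mulr_suml; ring.
Qed.

Lemma drift0 g j : (forall k, g (cur k) = 0) -> drift g j = 0.
Proof.
move=> g0; rewrite /drift big1 // => i _.
rewrite [displacement H g j]displacement_const0 //.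
by case: i => [i|] /=; rewrite ?displacement_const0 // subrr mulr0.
Qed.

Lemma delta_max_cur k : delta_max (cur k) = 0.
Proof. by rewrite /delta_max cur_neq_max. Qed.

Lemma gam_sum_delta_max : gam_sum delta_max = gam ord_max.
Proof. exact: sum_delta. Qed.

Lemma drift_max_eq g : drift g ord_max =
  dirichlet (ext g) (ext delta_max) - gam_sum g * gam ord_max.
Proof.
have := lam_polar hyp g delta_max.
rewrite (eq_bigr (fun j => drift g j * delta_max j)); last first.
  by move=> j _; exact: mulrC.
rewrite sum_delta [X in _ + X - _]big1 => [|j _]; last first.
  by rewrite drift0 ?mulr0 //; exact: delta_max_cur.
by rewrite gam_sum_delta_max; lra.
Qed.

(** The coefficient of g_n^2 in the hypothesis: the degree of n in the graph is gamma_n^2. *)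
Lemma gam_max_sq :
  gam ord_max ^+ 2 = lam_in lam ord_max + lam_out lam (Some ord_max).
Proof.
have := drift_max_eq delta_max; rewrite drift0; last exact: delta_max_cur.
rewrite gam_sum_delta_max dirichlet_delta_max /= mulr0 addr0 big1 => [|k _].
  by rewrite /delta_max eqxx mulr1; lra.
by rewrite delta_max_cur mulr0.
Qed.

(** By the flow balance at n, gamma_n^2 = 2 lambda_{n,.} + R_n, which is positive. *)
Lemma gam_max_gt0 : 0 < gam ord_max.
Proof.
rewrite lt_def gam_ge0 andbT; apply/negP => /eqP g0.
have := gam_max_sq; rewrite g0 lam_out_in eqxx mulr1 expr0n /=.
have : 0 <= lam_out lam (Some ord_max) by apply: sumr_ge0.
by rewrite lam_out_in eqxx mulr1; move: Rn_gt0; lra.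
Qed.

Lemma gam_max_neq0 : gam ord_max != 0. Proof. exact: lt0r_neq0 gam_max_gt0. Qed.

Lemma sigma_star : sigma None = 1.
Proof. by rewrite /= (lam_star hyp) divff // gam_max_neq0. Qed.

Lemma gam_sigma k : gam ord_max * sigma (Some k) =
  lam (Some (cur k)) ord_max + lam (Some ord_max) (cur k).
Proof. by rewrite /= mulrC divfK // gam_max_neq0. Qed.

Lemma sigma_ge0 i : 0 <= sigma i.
Proof.
by case: i => [k|] /=; rewrite divr_ge0 ?addr_ge0 // gam_ge0.
Qed.

(* a_1, ..., a_n, a_* placed at the indices 0, ..., n-1, *; the value at n is
   the one that makes [dirichlet] stationary there. *)
Definition harmonic_ext (a : option 'I_n -> R) (i : option 'I_n.+1) : R :=
  match i with
  | Some i => if unlift ord_max i is Some k then a (Some k)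
              else (\sum_j sigma j * a j) / gam ord_max
  | None => a None
  end.

#[global] Arguments harmonic_ext : simpl never.

Lemma cur_lift (k : 'I_n) : cur k = lift ord_max k.
Proof. by apply: val_inj; rewrite /= /bump leqNgt ltn_ord. Qed.

Lemma harmonic_cur a k : harmonic_ext a (Some (cur k)) = a (Some k).
Proof. by rewrite /harmonic_ext cur_lift liftK. Qed.

Lemma harmonic_max a : gam ord_max * harmonic_ext a (Some ord_max) =
  \sum_j sigma j * a j.
Proof. by rewrite /harmonic_ext unlift_none mulrC divfK // gam_max_neq0. Qed.

(** The vertex n has degree gamma_n^2 and edge weights gamma_n sigma_k, with sigma_* = 1, so one
    factor gamma_n comes out. The other factor vanishes exactly at the value that [harmonic_ext]
    puts at n. *)
Lemma dirichlet_max a : dirichlet a (ext delta_max) =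
  gam ord_max * (gam ord_max * a (Some ord_max) -
    (\sum_k sigma (Some k) * a (Some (cur k)) + a None)).
Proof.
rewrite dirichlet_delta_max -gam_max_sq.
under eq_bigr do rewrite -gam_sigma -mulrA.
by rewrite -mulr_sumr; ring.
Qed.

(** The two contributions of g_n to [drift_max_eq] cancel. *)
Lemma drift_max g : drift g ord_max =
  - gam ord_max * \sum_k (sigma (Some k) + gam (cur k)) * g (cur k).
Proof.
rewrite drift_max_eq dirichlet_max /gam_sum sum_cur /=.
under [in RHS]eq_bigr do rewrite mulrDl.
by rewrite big_split /=; ring.
Qed.

(** The indices 0 and * have zero displacement, so only the indices [nxt p] remain. The entries -
    lambda_{.,j} of [lam_tilde] account for the subtracted displacement at j. *)
Lemma drift_cur g j : drift g (cur j) =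
  \sum_l g (cur l) * (Htilde H *m lam_tilde lam) l j.
Proof.
have -> : drift g (cur j) =
    \sum_p displacement H g (nxt p) * lam_tilde lam p j.
  rewrite /drift; under eq_bigr do rewrite mulrBr.
  rewrite sumrB -mulr_suml sum_option /= mulr0 add0r.
  rewrite (big_ord_recl n) displacement0 mulr0 add0r.
  (* This also covers j = 0: no [nxt p] equals 0, and the displacement there is 0. *)
  have -> : displacement H g (cur j) =
      \sum_p displacement H g (nxt p) * (nxt p == cur j)%:R.
    transitivity (\sum_i displacement H g i * (i == cur j)%:R).
      by rewrite sum_delta.
    by rewrite (big_ord_recl n) displacement0 mul0r add0r.
  rewrite mulr_sumr -sumrB; apply: eq_bigr => p _.
  rewrite mxE -/(lam_in lam (cur j)) -/(nxt p); case: eqP => [->|_].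
    by rewrite lam_diag mulr1; ring.
  by rewrite mulr0n; ring.
under eq_bigr do rewrite displacement_Htilde // mulr_suml.
rewrite exchange_big; apply: eq_bigr => l _.
by rewrite mxE mulr_sumr; apply: eq_bigr => p _; rewrite mulrA.
Qed.

(** Multiplying by [Htilde H] removes the inverse in [mu_tilde]; what remains is the matrix of
    [drift_cur] and a rank-one term. *)
Lemma Htilde_mu_tilde g j :
  \sum_l (\sum_p Htilde H j p * mu_tilde p l) * g (cur l) =
  - (drift g (cur j)
     + gam (cur j) * \sum_k (sigma (Some k) + gam (cur k)) * g (cur k)).
Proof.
rewrite drift_cur mulr_sumr -big_split -sumrN /=; apply: eq_bigr => l _.
have /matrixP/(_ j l) : Htilde H *m mu_tilde = - ((Htilde H *m lam_tilde lam)^T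
    + gam_tilde gam *m (gam_tilde gam + sigma_tilde lam gam)^T).
  by rewrite /mu_tilde mulmxN mulmxA mulmxV ?mul1mx //; exact: Htilde_unit.
rewrite [in LHS]mxE => ->; rewrite !mxE big_ord1 !mxE /=; ring.
Qed.

End Multipliers.

(** * The composite identity for scalars *)

Section Multipliers.
Context {R : realType} {m : nat}.
Local Notation n := m.+1.
Variables (H : 'M[R]_n) (lam : option 'I_n.+1 -> 'I_n.+1 -> R).
Variables (gam : 'I_n.+1 -> R) (Rn : R).
Hypothesis hH : stepsize_matrix H.
Hypothesis lam_ge0 : forall i j, 0 <= lam i j.
Hypothesis lam_diag : forall j, lam (Some j) j = 0.
Hypothesis Rn_gt0 : 0 < Rn.
Hypothesis hyp : scalar_identity H lam gam Rn.
Local Notation lam_sum := (lam_sum lam).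
Local Notation drift := (drift H lam).
Local Notation dirichlet := (dirichlet lam).
Local Notation gam_sum := (gam_sum gam).
Local Notation sigma := (sigma lam gam).
Local Notation mu_tilde := (mu_tilde H lam gam).
Local Notation mu := (mu H lam gam).
Local Notation vv := (vv H lam gam).
Local Notation harmonic_ext := (harmonic_ext lam gam).

(** Turns [gam_sum] into a weighted sum over edges, so that identities can be checked edge by
    edge. *)
Lemma lam_sum_star phi :
  lam_sum (fun i j => phi j * (i == None)%:R) = gam_sum phi.
Proof.
rewrite lam_sumE [X in _ + X]big1 ?addr0 => [|i _]; last first.
  by rewrite big1 // => j _; rewrite !mulr0.
by apply: eq_bigr => j _; rewrite eqxx mulr1 (lam_star hyp).
Qed.

(** The constant 1 has zero energy against everything; read this off [dirichlet_max]. *)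
Lemma sum_sigma : \sum_k sigma (Some k) = gam ord_max - 1.
Proof.
have := dirichlet_max lam_ge0 lam_diag Rn_gt0 hyp (fun=> 1).
have -> : dirichlet (fun=> 1) (ext (fun i => (i == ord_max)%:R)) = 0.
  by rewrite /dirichlet /lam_sum big1 // => i _; rewrite big1 // => j _;
    rewrite subrr mul0r mulr0.
move/esym/eqP; rewrite mulf_eq0.
rewrite (negbTE (gam_max_neq0 lam_ge0 lam_diag Rn_gt0 hyp)) /= => /eqP.
by under eq_bigr do rewrite mulr1; rewrite /=; lra.
Qed.

Lemma sum_drift g : \sum_j drift g j = - Rn * displacement H g ord_max.
Proof.
have := lam_balance hyp (oapp (displacement H g) 0).
rewrite /= sub0r mulrN -mulNr => <-.
have := lam_sum_drift H lam (fun=> 1) g.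
under [X in _ = X -> _]eq_bigr do rewrite mul1r.
by move=> <-; apply: eq_lam_sum => i j; rewrite mul1r.
Qed.

Lemma dirichlet_one b : dirichlet (ext (fun=> 1)) (ext b) = gam_sum b.
Proof.
rewrite -lam_sum_star; apply: eq_lam_sum => -[i|] j /=; first by ring.
by rewrite mulr1; ring.
Qed.

Lemma drift_one j : drift (fun=> 1) j + gam j * (Rn - 1) =
  Rn * displacement H (fun i => (i == j)%:R) ord_max.
Proof.
have := lam_polar hyp (fun=> 1) (fun i => (i == j)%:R).
rewrite dirichlet_one.
have -> : \sum_k (k == j)%:R * drift (fun=> 1) k = drift (fun=> 1) j.
  by under eq_bigr do rewrite mulrC; rewrite sum_delta.
have -> : \sum_k 1 * drift (fun i => (i == j)%:R) k =
    - Rn * displacement H (fun i => (i == j)%:R) ord_max.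
  by rewrite -sum_drift; apply: eq_bigr => k _; rewrite mul1r.
have -> : gam_sum (fun i => (i == j)%:R) = gam j by exact: sum_delta.
have -> : gam_sum (fun=> 1) = Rn.
  by rewrite -(sum_gam hyp); apply: eq_bigr => k _; rewrite mulr1.
by lra.
Qed.

Lemma nxt_max : nxt (ord_max : 'I_n) = ord_max.
Proof. exact: val_inj. Qed.

(** This is the flow balance of mu that the values h_i require. After applying the invertible
    [Htilde H], it suffices that [Htilde_mu_tilde] at g = 1 equals - R_n times the last column of
    [Htilde H], which is [drift_one]. *)
Lemma mu_tilde_row_sum i :
  \sum_j mu_tilde i j = - Rn * (i == ord_max)%:R.
Proof.
suff /colP/(_ i) : mu_tilde *m const_mx 1 =
    \col_k (- Rn * (k == ord_max)%:R) :> 'cV_n.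
  rewrite [RHS]mxE [LHS]mxE => <-; apply: eq_bigr => j _.
  by rewrite [const_mx _ _ _]mxE mulr1.
apply: (can_inj (mulKmx (Htilde_unit hH))); apply/colP => j.
rewrite mulmxA [LHS]mxE [RHS]mxE.
have := Htilde_mu_tilde gam hH lam_diag (fun=> 1) j.
have -> : \sum_k (sigma (Some k) + gam (cur k)) * 1 = Rn - 1.
  under eq_bigr do rewrite mulr1.
  have := sum_gam hyp; rewrite big_split /= sum_sigma sum_cur; lra.
rewrite drift_one -nxt_max displacement_Htilde //= => E.
transitivity (- (Rn * Htilde H j ord_max)).
  have <- : \sum_l (cur l == cur j)%:R * Htilde H l ord_max =
      Htilde H j ord_max.
    by under eq_bigr do rewrite mulrC; rewrite (sum_delta (Htilde H ^~ _)).
  rewrite -E; apply: eq_bigr => l _.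
  by rewrite [const_mx _ _ _]mxE; congr (_ * _); rewrite [LHS]mxE.
rewrite (eq_bigr (fun p => (- Rn * Htilde H j p) * (p == ord_max)%:R)).
  by rewrite sum_delta mulNr.
by move=> p _; rewrite [(\col__ _) _ _]mxE; ring.
Qed.

Section Composite.
Variables (g : 'I_n.+1 -> R) (s : 'I_n -> R) (ss w : R).
Let a := oapp s ss.
(** c lists s_1, ..., s_n and then t. Displacements ignore the last value, so those of G are the
    displacements of the composite method. *)
Let c i := harmonic_ext a (Some i).
Let G i := g i + c i.

Let c_cur k : c (cur k) = s k.
Proof. by rewrite /c harmonic_cur. Qed.

Lemma gam_sum_harmonic : gam_sum c =
  \sum_k (sigma (Some k) + gam (cur k)) * s k + ss.
Proof.
rewrite /gam_sum sum_cur (eq_bigr (fun k => gam (cur k) * s k)); last first.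
  by move=> k _; rewrite c_cur.
rewrite /c (harmonic_max lam_ge0 lam_diag Rn_gt0 hyp).
rewrite sum_option (sigma_star lam_ge0 lam_diag Rn_gt0 hyp) /= mul1r.
under [in RHS]eq_bigr do rewrite mulrDl.
by rewrite big_split /=; ring.
Qed.

Lemma composite_smooth_part (f : 'I_n.+1 -> R) fs :
  let F := oapp f fs in
  let X := oapp (fun i => - displacement H G i) (- w) in
  let g' := oapp g (- ss) in
  lam_sum (fun i j => F i - F (Some j) - g j * (X i - X (Some j))
                      - 2^-1 * (g' i - g' (Some j)) ^+ 2)
  + 2^-1 * (w - gam_sum G) ^+ 2 =
  Rn * (fs - f ord_max) + 2^-1 * w ^+ 2 - w * gam_sum c
  - \sum_l s l * (\sum_p mu_tilde p l * displacement H G (nxt p))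
  - 2^-1 * dirichlet (harmonic_ext a) (harmonic_ext a).
Proof.
move=> F X g'; have := hyp f fs G w; rewrite /= -/F -/X.
set A := lam_sum _ => hA; set B := lam_sum _.
(* Compared edge by edge, using that g' is [ext G] minus [harmonic_ext a]. The term in [ss] appears
   because [ext c] is 0 at *, whereas [harmonic_ext a] is [ss] there. *)
have BA : B - A = - \sum_j c j * drift G j - w * gam_sum c
    + dirichlet (ext G) (ext c) - ss * gam_sum G
    - 2^-1 * dirichlet (harmonic_ext a) (harmonic_ext a).
  rewrite -lam_sum_drift -!lam_sum_star.
  rewrite !(lam_sumZ, lam_sumN, lam_sumD); apply: eq_lam_sum => i j.
  rewrite /F /X /g' /G /c; case: i => [i|] /=.
    move: (displacement _ _ i) (displacement _ _ j) => di dj; by field.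
  rewrite -[harmonic_ext a None]/ss.
  by move: (displacement _ _ j) => dj; field.
(* By [drift_max], the index n drops out: its term cancels against gamma_n G_n in [gam_sum G]. The
   other indices are rows of [Htilde_mu_tilde]. *)
have cross : - \sum_l s l * (\sum_p mu_tilde p l * displacement H G (nxt p)) =
    \sum_j G j * drift c j + gam_sum G * (gam_sum c - ss).
  rewrite gam_sum_harmonic addrK (sum_cur (fun j => G j * _ j)) /gam_sum.
  rewrite (sum_cur (fun j => _ j * G j)).
  rewrite (drift_max lam_ge0 lam_diag Rn_gt0 hyp).
  under [X in - _ * X]eq_bigr do rewrite c_cur.
  set P := \sum_k (sigma (Some k) + gam (cur k)) * s k.
  have -> : \sum_i G (cur i) * drift c (cur i) + G ord_max * (- gam ord_max * P)
      + (\sum_i gam (cur i) * G (cur i) + gam ord_max * G ord_max) * P =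
      \sum_i G (cur i) * (drift c (cur i) + gam (cur i) * P).
    under [in RHS]eq_bigr do rewrite mulrDr.
    rewrite big_split /=.
    under [X in _ = _ + X]eq_bigr do rewrite mulrCA mulrA.
    by rewrite -mulr_suml; ring.
  have E i : drift c (cur i) + gam (cur i) * P =
      - \sum_l (\sum_p Htilde H i p * mu_tilde p l) * s l.
    have := Htilde_mu_tilde gam hH lam_diag c i.
    under eq_bigr do rewrite c_cur.
    under [X in _ = - (_ + _ * X)]eq_bigr do rewrite c_cur.
    by move=> ->; rewrite opprK.
  under [in RHS]eq_bigr do rewrite E mulrN.
  rewrite sumrN; congr (- _).
  under [in RHS]eq_bigr do rewrite mulr_sumr.
  rewrite exchange_big; apply: eq_bigr => l _ /=.
  under [in RHS]eq_bigr do rewrite mulrA mulrC mulr_sumr.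
  rewrite -mulr_sumr exchange_big /=; congr (_ * _); apply: eq_bigr => p _.
  rewrite displacement_Htilde // mulr_sumr; apply: eq_bigr => i _.
  by ring.
(* Trades the pairing of c with the drift of G for the pairing of G with the drift of c, which
   [cross] evaluates. *)
have := lam_polar hyp G c; rewrite -/B.
have -> : B = A + (B - A) by ring.
rewrite {}BA => pol; move: hA cross pol; lra.
Qed.

(** At i = j the difference of phi vanishes, so mu may be replaced by [mu_tilde] with its diagonal.
    The entry at * makes each column sum to zero, so the terms in phi_j cancel. *)
Lemma mu_sum (psi : 'I_n -> R) (phi : option 'I_n -> R) :
  \sum_i \sum_j mu i j * (psi j * (phi i - phi (Some j))) =
  \sum_j psi j * (\sum_p mu_tilde p j * phi (Some p)) +
  phi None * \sum_j psi j * mu None j.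
Proof.
rewrite exchange_big mulr_sumr -big_split; apply: eq_bigr => j _ /=.
rewrite sum_option.
have -> : \sum_i mu (Some i) j * (psi j * (phi (Some i) - phi (Some j))) =
    \sum_i psi j * (mu_tilde i j * phi (Some i) - mu_tilde i j * phi (Some j)).
  apply: eq_bigr => i _ /=; case: eqP => [->|_]; last by ring.
  by rewrite !subrr mulr0 mul0r.
by rewrite -mulr_sumr sumrB -mulr_suml /=; ring.
Qed.

Lemma sum_mu_star : \sum_j mu None j = Rn.
Proof.
rewrite /= sumrN exchange_big /=; under eq_bigr do rewrite mu_tilde_row_sum.
by rewrite sum_delta opprK.
Qed.

(** The row sums of [mu_tilde] leave only h_n and h_*. The last term is the opposite of the one left
    by [composite_smooth_part]. *)
Lemma composite_nonsmooth_part (h : 'I_n -> R) hs :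
  let X := oapp (fun k => - displacement H G (nxt k)) (- w) in
  let h' := oapp h hs in
  \sum_i \sum_j mu i j * (h' i - h' (Some j) - s j * (X i - X (Some j))) =
  Rn * (hs - h ord_max) + w * \sum_j mu None j * s j
  + \sum_l s l * (\sum_p mu_tilde p l * displacement H G (nxt p)).
Proof.
move=> X h'.
have -> : \sum_i \sum_j mu i j * (h' i - h' (Some j) - s j * (X i - X (Some j)))
   = \sum_i \sum_j mu i j * (1 * (h' i - h' (Some j))) -
     \sum_i \sum_j mu i j * (s j * (X i - X (Some j))).
  rewrite -sumrB; apply: eq_bigr => i _; rewrite -sumrB; apply: eq_bigr => j _.
  by ring.
rewrite (mu_sum (fun=> 1) h') (mu_sum s X).
under eq_bigr do rewrite mul1r.
rewrite exchange_big /=; under eq_bigr do rewrite -mulr_suml mu_tilde_row_sum.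
under [X in _ + h' None * X - _]eq_bigr do rewrite mul1r.
rewrite sum_mu_star.
rewrite (eq_bigr (fun i => (- Rn * h i) * (i == ord_max)%:R)); last first.
  by move=> i _; rewrite mulrAC.
rewrite sum_delta /X /h' /=.
under [X in _ - (X + _)]eq_bigr => l _.
  under eq_bigr do rewrite mulrN.
  rewrite sumrN mulrN; over.
rewrite sumrN.
have -> : \sum_j mu None j * s j = \sum_j s j * mu None j.
  by apply: eq_bigr => j _; rewrite mulrC.
by ring.
Qed.

(** The right-hand side is what the smooth and nonsmooth parts leave as the factor of - w; the
    border v of S cancels it. *)
Lemma sum_vv : \sum_i vv i * a i =
  gam_sum c - \sum_j mu None j * s j.
Proof.
rewrite gam_sum_harmonic sum_option addrAC -sumrB [LHS]addrC; congr (_ + _).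
  apply: eq_bigr => k _.
  by rewrite [vv _]/Defs.vv (lam_star hyp) /a [oapp _ _ _]/=; ring.
by rewrite [vv _](sigma_star lam_ge0 lam_diag Rn_gt0 hyp) mul1r.
Qed.

(** The last bracket is a diagonal entry of V S V^T, by [Smat_quad] and [Lmat_quad]. *)
Lemma scalar_composite_identity (f : 'I_n.+1 -> R) fs (h : 'I_n -> R) hs xi :
  let F := oapp f fs in
  let X := oapp (fun i => - displacement H G i) (- w) in
  let g' := oapp g (- ss) in
  let X' := oapp (fun k => - displacement H G (nxt k)) (- w) in
  let h' := oapp h hs in
  lam_sum (fun i j => F i - F (Some j) - g j * (X i - X (Some j))
                      - 2^-1 * (g' i - g' (Some j)) ^+ 2)
  + \sum_i \sum_j mu i j * (h' i - h' (Some j) - s j * (X' i - X' (Some j)))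
  + 2^-1 * (w - gam_sum G) ^+ 2
  + 2^-1 * (xi * w ^+ 2 + 2 * w * (\sum_i vv i * a i)
            + dirichlet (harmonic_ext a) (harmonic_ext a)) =
  Rn * ((fs + hs) - (f ord_max + h ord_max)) + 2^-1 * (1 + xi) * w ^+ 2.
Proof.
move=> F X g' X' h'; have := composite_smooth_part f fs.
have := composite_nonsmooth_part h hs; rewrite sum_vv /=.
by rewrite /F /X /g' /X' /h'; lra.
Qed.

End Composite.
End Multipliers.

(** * The matrices L and S *)

Section Laplacian.
Context {R : realType} {m : nat}.
Local Notation n := m.+1.
Variables (H : 'M[R]_n) (lam : option 'I_n.+1 -> 'I_n.+1 -> R).
Variables (gam : 'I_n.+1 -> R) (Rn : R).
Hypothesis hH : stepsize_matrix H.
Hypothesis lam_ge0 : forall i j, 0 <= lam i j.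
Hypothesis lam_diag : forall j, lam (Some j) j = 0.
Hypothesis Rn_gt0 : 0 < Rn.
Hypothesis hyp : scalar_identity H lam gam Rn.
Local Notation lam_sum := (lam_sum lam).
Local Notation drift := (drift H lam).
Local Notation dirichlet := (dirichlet lam).
Local Notation gam_sum := (gam_sum gam).
Local Notation sigma := (sigma lam gam).
Local Notation mu_tilde := (mu_tilde H lam gam).
Local Notation mu := (mu H lam gam).
Local Notation vv := (vv H lam gam).
Local Notation harmonic_ext := (harmonic_ext lam gam).
Local Notation L := (Lmat lam gam).

Let split_l (k : 'I_n) : fintype.split (lshift 1 k) = inl k.
Proof. exact: (unsplitK (inl k)). Qed.
Let split_r (k : 'I_1) : fintype.split (rshift n k) = inr k.
Proof. exact: (unsplitK (inr k)). Qed.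
Let splitE := (split_l, split_r).

Lemma star_colE (a : option 'I_n -> R) i j :
  star_col a i j = if fintype.split i is inl k then a (Some k) else a None.
Proof.
by rewrite mxE; case: fintype.split => k; rewrite ?ord1 mxE ?ord1 ?mulr1n.
Qed.

Lemma star_colP (x : 'cV[R]_(n + 1)) : exists a, x = star_col a.
Proof.
exists (fun i => if i is Some k then x (lshift 1 k) 0 else x (rshift n 0) 0).
apply/colP => i; rewrite star_colE; case: (split_ordP i) => k -> //.
by rewrite ord1.
Qed.

Lemma star_col_dot (a b : option 'I_n -> R) :
  ((star_col a)^T *m star_col b) 0 0 = \sum_i a i * b i.
Proof.
rewrite mxE sum_option big_split_ord /= big_ord1 addrC.
under [X in _ + X = _]eq_bigr do rewrite mxE !star_colE !splitE.
by rewrite mxE !star_colE !splitE.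
Qed.

Lemma LmatE i j : L i j =
  match fintype.split i, fintype.split j with
  | inl i, inl j => - lam_hat lam i j - sigma (Some i) * sigma (Some j)
  | inl i, inr _ => - gam (cur i) - sigma (Some i) * sigma None
  | inr _, inl j => - gam (cur j) - sigma None * sigma (Some j)
  | inr _, inr _ => lam_out lam None - sigma None * sigma None
  end.
Proof.
rewrite [LHS]mxE [X in X + _]mxE [X in _ + X]mxE [X in _ - X]mxE.
rewrite big_ord1 [(_^T) _ _]mxE !star_colE.
case: (split_ordP i) => k ->; case: (split_ordP j) => l ->.
- by rewrite block_mxEul ?splitE.
- by rewrite block_mxEur ?splitE mxE.
- by rewrite block_mxEdl ?splitE !mxE.
- by rewrite block_mxEdr ?splitE !ord1 mxE eqxx mulr1n opprK.
Qed.

Lemma lam_hatE i j : lam_hat lam i j =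
  lam (Some (cur i)) (cur j) + lam (Some (cur j)) (cur i)
  - (lam_in lam (cur i) + lam_out lam (Some (cur i))) * (j == i)%:R.
Proof.
rewrite mxE eq_sym; case: eqP => [->|_]; last by rewrite mulr0 subr0.
by rewrite lam_diag mulr1 addr0 sub0r.
Qed.

Lemma Lmat_sym : L^T = L.
Proof.
have hatE i j : lam_hat lam i j = lam_hat lam j i.
  rewrite !mxE eq_sym; case: eqP => [->|_] //; exact: addrC.
apply/matrixP => i j; rewrite [LHS]mxE !LmatE.
case: fintype.split => k; case: fintype.split => l //.
- by rewrite hatE mulrC.
- by rewrite [in RHS]mulrC.
- by rewrite [in RHS]mulrC.
Qed.

(** The diagonal carries the full degree, so the row sum is minus the weight of the missing edges,
    those to * and to n. *)
Lemma sum_lam_hat i :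
  \sum_j lam_hat lam i j = - gam (cur i) - gam ord_max * sigma (Some i).
Proof.
rewrite (gam_sigma lam_ge0 lam_diag Rn_gt0 hyp).
under eq_bigr do rewrite lam_hatE.
rewrite sumrB big_split /= sum_delta /lam_in /lam_out sum_option !sum_cur.
by rewrite (lam_star hyp); ring.
Qed.

Lemma Lmat_laplacian : laplacian L.
Proof.
have g0 := gam_ge0 lam_ge0 hyp; have s0 := sigma_ge0 lam_ge0 hyp.
split; first exact: Lmat_sym.
  move=> i j ne_ij; rewrite LmatE.
  have ss k l : 0 <= sigma k * sigma l by rewrite mulr_ge0.
  case: (split_ordP i) ne_ij => k ->; case: (split_ordP j) => l -> ne_kl.
  - have [ne_lk | e] := eqVneq l k; first by rewrite ne_lk eqxx in ne_kl.
    rewrite lam_hatE (negbTE e) mulr0 subr0.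
    have := ss (Some k) (Some l); have := lam_ge0 (Some (cur k)) (cur l).
    by have := lam_ge0 (Some (cur l)) (cur k); lra.
  - by have := ss (Some k) None; have := g0 (cur k); lra.
  - by have := ss None (Some l); have := g0 (cur l); lra.
  - by rewrite !ord1 eqxx in ne_kl.
(* The row sums reduce to two totals: the sigma_i, including sigma_* = 1, sum to gamma_n, and the
   gamma_i sum to R_n. *)
move=> i; rewrite big_split_ord /= big_ord1.
under eq_bigr do rewrite LmatE splitE.
rewrite LmatE splitE; have Es := sum_sigma lam_ge0 lam_diag Rn_gt0 hyp.
have E1 := sigma_star lam_ge0 lam_diag Rn_gt0 hyp.
case: fintype.split => k.
  by rewrite sumrB sumrN sum_lam_hat -mulr_sumr Es E1; ring.
rewrite sumrB sumrN -mulr_sumr Es E1 (lam_out_star hyp).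
have := sum_gam hyp; rewrite sum_cur; lra.
Qed.

Lemma sum_vv_one : \sum_i vv i = 0.
Proof.
have E1 := sigma_star lam_ge0 lam_diag Rn_gt0 hyp.
have := sum_gam hyp; rewrite sum_cur => Eg.
have Em := sum_mu_star hH lam_ge0 lam_diag Rn_gt0 hyp.
have Es := sum_sigma lam_ge0 lam_diag Rn_gt0 hyp.
rewrite sum_option [vv None]E1.
have -> : \sum_k vv (Some k) =
    \sum_k sigma (Some k) + \sum_k gam (cur k) - \sum_k mu None k.
  rewrite -big_split -sumrB; apply: eq_bigr => k _.
  by rewrite /Defs.vv (lam_star hyp).
by rewrite Em Es; move: Eg; lra.
Qed.

(** In the energy, the value z at n enters as gamma_n^2 z^2 - 2 gamma_n z P with P = \sum_i sigma_i
    a_i. At gamma_n z = P this is - P^2, the contribution of - sigma sigma^T to L. *)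
Lemma Lmat_quad (a : option 'I_n -> R) :
  ((star_col a)^T *m L *m star_col a) 0 0 =
  dirichlet (harmonic_ext a) (harmonic_ext a).
Proof.
have quadE : ((star_col a)^T *m L *m star_col a) 0 0 =
    - \sum_k \sum_l lam_hat lam k l * (a (Some k) * a (Some l))
    - (\sum_i sigma i * a i) ^+ 2
    - 2 * a None * (\sum_k gam (cur k) * a (Some k)) + Rn * a None ^+ 2.
  rewrite -mulmxA [LHS]mxE big_split_ord /= big_ord1.
  under eq_bigr => k _.
    rewrite mxE star_colE splitE mxE big_split_ord /= big_ord1.
    under eq_bigr do rewrite LmatE star_colE !splitE mulrBl mulNr -mulrA.
    rewrite sumrB sumrN -mulr_sumr LmatE star_colE !splitE.
    rewrite (_ : _ * _ = - \sum_l lam_hat lam k l * (a (Some k) * a (Some l))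
      - (sigma (Some k) * a (Some k)) * (\sum_i sigma i * a i)
      - a None * (gam (cur k) * a (Some k))); first over.
    rewrite sum_option; set P := \sum_i sigma _ * _.
    under [in RHS]eq_bigr do rewrite mulrCA.
    by rewrite -mulr_sumr; ring.
  rewrite !sumrB sumrN -mulr_suml -mulr_sumr.
  rewrite mxE star_colE splitE mxE big_split_ord /= big_ord1.
  under [X in _ + _ * (X + _)]eq_bigr do
    rewrite LmatE star_colE !splitE mulrBl mulNr -mulrA.
  rewrite sumrB sumrN -mulr_sumr LmatE star_colE !splitE (lam_out_star hyp).
  by rewrite [\sum_i sigma i * a i]sum_option; ring.
rewrite {}quadE -(harmonic_max lam_ge0 lam_diag Rn_gt0 hyp).
set c := harmonic_ext a.
have cE k : c (Some (cur k)) = a (Some k) by exact: harmonic_cur.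
have cN : c None = a None by [].
have -> : dirichlet c c = lam_sum (fun i _ => c i ^+ 2)
    + lam_sum (fun _ j => c (Some j) ^+ 2)
    - 2 * lam_sum (fun i j => c i * c (Some j)).
  rewrite !(lam_sumZ, lam_sumN, lam_sumD); apply: eq_lam_sum => i j; ring.
rewrite lam_sum_out (lam_sum_in lam (fun j => c (Some j) ^+ 2)) sum_option.
rewrite (lam_out_star hyp).
(* T collects the edges among 0, ..., n-1, and D their degrees. *)
pose T := \sum_k \sum_l
  lam (Some (cur k)) (cur l) * (a (Some k) * a (Some l)).
pose D := \sum_k (lam_in lam (cur k) + lam_out lam (Some (cur k)))
  * a (Some k) ^+ 2.
have -> : \sum_k \sum_l lam_hat lam k l * (a (Some k) * a (Some l)) =
    2 * T - D.
  transitivity (T + \sum_k \sum_l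
      lam (Some (cur l)) (cur k) * (a (Some k) * a (Some l)) - D).
    rewrite -big_split -sumrB; apply: eq_bigr => k _ /=.
    rewrite -big_split -[X in _ - X](sum_delta (fun l => (lam_in lam (cur k)
      + lam_out lam (Some (cur k))) * (a (Some k) * a (Some l)))) -sumrB.
    by apply: eq_bigr => l _; rewrite lam_hatE /=; ring.
  have -> : \sum_k \sum_l
      lam (Some (cur l)) (cur k) * (a (Some k) * a (Some l)) = T.
    rewrite exchange_big; apply: eq_bigr => k _; apply: eq_bigr => l _ /=.
    by rewrite [a _ * _]mulrC.
  by ring.
have -> : lam_sum (fun i j => c i * c (Some j)) =
    T + a None * (\sum_k gam (cur k) * a (Some k))
      + gam ord_max * c (Some ord_max) * (\sum_i sigma i * a i).
  rewrite lam_sumE (sum_cur (fun j => lam None j * _)).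
  rewrite (sum_cur (fun i => \sum_j lam (Some i) j * _)).
  rewrite (sum_cur (fun j => lam (Some ord_max) j * _)) lam_diag mul0r addr0.
  under [X in _ + (X + _) = _]eq_bigr do rewrite sum_cur.
  rewrite big_split /= [\sum_i sigma i * a i]sum_option.
  rewrite (sigma_star lam_ge0 lam_diag Rn_gt0 hyp) mul1r !(lam_star hyp).
  rewrite [gam _ * _ * (_ + _)]mulrDr.
  have -> : gam ord_max * c (Some ord_max) * \sum_k sigma (Some k) * a (Some k)
    = \sum_k lam (Some (cur k)) ord_max * (c (Some (cur k)) * c (Some ord_max))
    + \sum_k lam (Some ord_max) (cur k) * (c (Some ord_max) * c (Some (cur k))).
    rewrite -big_split mulr_sumr; apply: eq_bigr => k _ /=.
    rewrite cE mulrACA (gam_sigma lam_ge0 lam_diag Rn_gt0 hyp); ring.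
  have -> : \sum_k \sum_l lam (Some (cur k)) (cur l) *
      (c (Some (cur k)) * c (Some (cur l))) = T.
    by apply: eq_bigr => k _; apply: eq_bigr => l _; rewrite !cE.
  have -> : \sum_k lam None (cur k) * (c None * c (Some (cur k))) =
      a None * \sum_k gam (cur k) * a (Some k).
    rewrite mulr_sumr; apply: eq_bigr => k _.
    by rewrite cE (lam_star hyp) mulrCA.
  by rewrite cN; ring.
have -> : \sum_i lam_out lam (Some i) * c (Some i) ^+ 2 =
    D + gam ord_max ^+ 2 * c (Some ord_max) ^+ 2
    - \sum_j lam_in lam j * c (Some j) ^+ 2.
  rewrite (gam_max_sq lam_diag hyp).
  rewrite (sum_cur (fun i => lam_out lam (Some i) * _)).
  rewrite (sum_cur (fun j => lam_in lam j * _)).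
  have -> : D = \sum_k lam_in lam (cur k) * c (Some (cur k)) ^+ 2
      + \sum_k lam_out lam (Some (cur k)) * c (Some (cur k)) ^+ 2.
    by rewrite -big_split; apply: eq_bigr => k _; rewrite cE mulrDl.
  by ring.
by rewrite -(harmonic_max lam_ge0 lam_diag Rn_gt0 hyp) cN -/c; ring.
Qed.

Lemma dirichlet_ge0 a : 0 <= dirichlet a a.
Proof.
apply: sumr_ge0 => i _; apply: sumr_ge0 => j _.
by rewrite mulr_ge0 // -expr2 sqr_ge0.
Qed.

Lemma dirichlet_eq0 a i j : dirichlet a a = 0 ->
  lam i j * (a i - a (Some j)) = 0.
Proof.
have ge0 k l : 0 <= lam k l * ((a k - a (Some l)) * (a k - a (Some l))).
  by rewrite mulr_ge0 // -expr2 sqr_ge0.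
move/eqP; rewrite psumr_eq0 => [/allP/(_ i)|k _]; last exact: sumr_ge0.
rewrite mem_index_enum => /(_ isT).
rewrite psumr_eq0 => [/allP/(_ j)|k _] //.
rewrite mem_index_enum => /(_ isT); rewrite !mulf_eq0 orbb.
by case/orP => /eqP ->; rewrite ?mul0r ?mulr0.
Qed.

(** Orthogonality of v to the kernel of L, for kernel vectors normalized by a_* = 0. *)
Lemma vv_kernel (a : option 'I_n -> R) : a None = 0 ->
  dirichlet (harmonic_ext a) (harmonic_ext a) = 0 -> \sum_i vv i * a i = 0.
Proof.
move=> a0 /dirichlet_eq0 edge.
pose s k := a (Some k); pose c i := harmonic_ext a (Some i).
have aE : a = oapp s 0 by apply: funext => -[k|].
have extE i : ext c i = harmonic_ext a i by case: i.
(* The edges from * have weights gamma_j, and the value at * is 0. *)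
have gc j : gam j * c j = 0.
  have := edge None j; rewrite (lam_star hyp) (a0 : harmonic_ext a None = 0).
  by rewrite sub0r mulrN => /eqP; rewrite oppr_eq0 => /eqP.
have cmax : c ord_max = 0.
  apply/eqP; have /eqP := gc ord_max; rewrite mulf_eq0.
  by rewrite (negbTE (gam_max_neq0 lam_ge0 lam_diag Rn_gt0 hyp)).
have gc0 : gam_sum c = 0 by apply: big1 => j _.
have pol j : drift c j = 0.
  pose g k : R := (k == j)%:R; have := lam_polar hyp c g.
  have -> : dirichlet (ext c) (ext g) = 0.
    apply: big1 => k _; apply: big1 => l _.
    by rewrite mulrA !extE edge mul0r.
  rewrite gc0 mul0r -(lam_sum_drift H lam c).
  have -> : \sum_k g k * drift c k = drift c j.
    by under eq_bigr do rewrite mulrC; rewrite sum_delta.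
  rewrite (_ : lam_sum _ = 0); first by lra.
  (* Since c is constant along edges of positive weight, it can be moved inside the difference of
     displacements. [lam_balance] then leaves only the values of F at * and n, which are 0. *)
  pose F i := ext c i * oapp (displacement H g) 0 i.
  have := lam_balance hyp F.
  have -> : F None - F (Some ord_max) = 0 by rewrite /F /= cmax; ring.
  rewrite mulr0; apply: etrans.
  apply: eq_bigr => k _; apply: eq_bigr => l _.
  have := edge k l; rewrite -!extE /ext mulrBr => /eqP.
  rewrite subr_eq0 => /eqP E.
  rewrite [RHS]mulrBr /F /ext [in RHS]mulrA E /=.
  ring.
(* With s_* = 0 the sum in [Htilde_mu_tilde] is [gam_sum c], so both of its terms vanish, and
   [Htilde H] is invertible. *)
have mt0 i : \sum_j mu_tilde i j * s j = 0.
  suff /colP/(_ i) : mu_tilde *m (\col_j s j) = 0 :> 'cV_n.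
    rewrite [LHS]mxE [RHS]mxE; apply: etrans; apply: eq_bigr => j _.
    by rewrite [(\col__ _) _ _]mxE.
  apply: (can_inj (mulKmx (Htilde_unit hH))); apply/colP => j.
  rewrite mulmx0 mulmxA [LHS]mxE [RHS]mxE.
  have := Htilde_mu_tilde gam hH lam_diag c j; rewrite pol add0r.
  have := gam_sum_harmonic lam_ge0 lam_diag Rn_gt0 hyp s 0; rewrite -aE.
  rewrite -/c gc0 addr0 => E.
  have cs k : c (cur k) = s k by exact: harmonic_cur.
  under [X in _ = - (_ * X) -> _]eq_bigr do rewrite cs.
  rewrite -E mulr0 oppr0; apply: etrans; apply: eq_bigr => l _.
  by rewrite [(\col__ _) _ _]mxE cs; congr (_ * _); rewrite [LHS]mxE.
have := sum_vv lam_ge0 lam_diag Rn_gt0 hyp s 0; rewrite -aE -/c gc0 sub0r.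
move=> ->; rewrite [\sum_j _](_ : _ = 0) ?oppr0 //.
under eq_bigr do rewrite /= mulNr mulr_suml.
by rewrite sumrN exchange_big big1 ?oppr0 // => i _; exact: mt0.
Qed.

Lemma vv_range : exists z, star_col vv = L *m z.
Proof.
(* As L is symmetric, its row space may be used; membership is tested on the columns of [cokermx L],
   which lie in the kernel of L. *)
suff /submxP [y E] : ((star_col vv)^T <= L)%MS.
  by exists y^T; apply: trmx_inj; rewrite E trmx_mul trmxK Lmat_sym.
rewrite submxE; apply/eqP/rowP => j; rewrite [RHS]mxE.
set K := cokermx L.
have LK : L *m col j K = 0 by rewrite colE mulmxA mulmx_coker mul0mx.
rewrite [LHS](_ : _ = ((star_col vv)^T *m col j K) 0 0); last first.
  rewrite [LHS]mxE [RHS]mxE; apply: eq_bigr => k _.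
  by rewrite [col _ _ _ _]mxE.
have [a aE] := star_colP (col j K); rewrite aE star_col_dot.
(* The shift by a constant normalizes b_* = 0. It stays in the kernel because the rows of L sum to
   0, and the pairing with v is unchanged because the entries of v sum to 0. *)
pose b i := a i - a None.
have bE : star_col b = star_col a - a None *: star_col (fun=> 1).
  apply/colP => i; rewrite [RHS]mxE [X in _ + X]mxE [X in _ - X]mxE !star_colE.
  by case: fintype.split => k; rewrite /b mulr1.
have L1 : L *m star_col (fun=> 1) = 0.
  apply/colP => i; rewrite [LHS]mxE [RHS]mxE; have [_ _] := Lmat_laplacian.
  move/(_ i); apply: etrans; apply: eq_bigr => k _.
  by rewrite star_colE; case: fintype.split => l; rewrite mulr1.
have Lb : L *m star_col b = 0.
  by rewrite bE mulmxBr -scalemxAr L1 scaler0 subr0 -aE.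
have : \sum_i vv i * b i = 0.
  apply: vv_kernel; first by rewrite /b subrr.
  by rewrite -Lmat_quad -mulmxA Lb mulmx0 mxE.
have -> : \sum_i vv i * b i = \sum_i vv i * a i - (\sum_i vv i) * a None.
  by rewrite mulr_suml -sumrB; apply: eq_bigr => i _; rewrite mulrBr.
by rewrite sum_vv_one mul0r subr0.
Qed.

Lemma Smat_quad xi w (y : 'cV[R]_(n + 1)) :
  ((col_mx w%:M y)^T *m Smat H lam gam xi *m col_mx w%:M y) 0 0 =
  xi * w ^+ 2 + 2 * w * ((star_col vv)^T *m y) 0 0 + (y^T *m L *m y) 0 0.
Proof.
rewrite /Smat tr_col_mx mul_row_block mul_row_col tr_scalar_mx !mul_scalar_mx.
rewrite !mulmxDl -!scalemxAl !mul_mx_scalar.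
have -> : y^T *m star_col vv = ((star_col vv)^T *m y)^T.
  by rewrite trmx_mul trmxK.
move: ((star_col vv)^T *m y) (y^T *m L *m y) => p q.
by rewrite !mxE eqxx mulr1n; ring.
Qed.

(** Write v = L z. Then L L^+ L = L gives xi = z^T L z, and the form of S at (w, y) is the energy of
    y + w z. *)
Lemma Smat_psd xi :
  xi = ((star_col vv)^T *m mp_inv L *m star_col vv) 0 0 ->
  psd (Smat H lam gam xi).
Proof.
move=> xiE; split.
  by rewrite tr_block_mx tr_scalar_mx trmxK Lmat_sym.
have [z zE] := vv_range.
have {}xiE : xi = (z^T *m L *m z) 0 0.
  have [LPL _ _ _] := mp_invP L.
  rewrite xiE zE trmx_mul Lmat_sym -[in RHS]LPL.
  by rewrite !mulmxA.
move=> x; rewrite -[x]vsubmxK [usubmx x]mx11_scalar.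
set w := usubmx x 0 0; set y := dsubmx x.
rewrite Smat_quad xiE zE trmx_mul Lmat_sym.
have [a aE] := star_colP (y + w *: z).
have := dirichlet_ge0 (harmonic_ext a); rewrite -Lmat_quad -aE.
move: L Lmat_sym => M Msym.
have -> : (y + w *: z)^T = y^T + w *: z^T by rewrite linearD linearZ.
rewrite !mulmxDl !mulmxDr -!scalemxAl -!scalemxAr.
have -> : y^T *m M *m z = (z^T *m M *m y)^T.
  by rewrite !trmx_mul trmxK Msym mulmxA.
move: (y^T *m M *m y) (z^T *m M *m y) (z^T *m M *m z) => A B C.
by rewrite !mxE; move: (A 0 0) (B 0 0) (C 0 0) => {}A {}B {}C; lra.
Qed.

End Laplacian.

(** * Passage between scalars and R^d *)

Section Euclidean.
Context {R : realType} {d : nat}.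
Implicit Types u v : 'cV[R]_d.

Lemma dotE u v : dot u v = \sum_r u r 0 * v r 0.
Proof. by rewrite /dot mxE; apply: eq_bigr => r _; rewrite mxE. Qed.

Lemma dot_ge0 u : 0 <= dot u u.
Proof. by rewrite dotE sumr_ge0 // => r _; rewrite -expr2 sqr_ge0. Qed.

Lemma enorm_sq u : enorm u ^+ 2 = dot u u.
Proof. by rewrite sqr_sqrtr // dot_ge0. Qed.

End Euclidean.

Section Lifting.
Context {R : realType} {d m : nat}.
Local Notation n := m.+1.
Variables (H : 'M[R]_n) (lam : option 'I_n.+1 -> 'I_n.+1 -> R).
Variables (gam : 'I_n.+1 -> R) (Rn : R).
Hypothesis hd : (0 < d)%N.
Hypothesis hH : stepsize_matrix H.
Hypothesis lam_ge0 : forall i j, 0 <= lam i j.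
Hypothesis lam_diag : forall j, lam (Some j) j = 0.
Hypothesis Rn_gt0 : 0 < Rn.
Hypothesis hyp : unconstrained_identity d H lam gam Rn.

Let r0 : 'I_d := Ordinal hd.

(** Scalars are embedded along one coordinate vector, which exists as d > 0, with x_0 = 0. *)
Lemma unconstrained_scalar : scalar_identity H lam gam Rn.
Proof.
pose e : 'cV[R]_d := delta_mx r0 0.
have dote a b : dot (a *: e) (b *: e) = a * b.
  rewrite dotE (bigD1 r0) //= big1 => [|r /negbTE ne]; rewrite !mxE ?eqxx.
    by rewrite !mulr1 addr0.
  by rewrite ne !mulr0.
move=> f fs g w F X.
have rec : first_order_method H (fun i => - displacement H g i *: e)
    (fun i => g i *: e).
  move=> k; rewrite displacement_nxt opprD scalerDl; congr (_ + _).
  rewrite scaleNr scaler_suml; congr (- _); apply: eq_bigr => j _.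
  by rewrite scalerA.
have := hyp f fs (- w *: e) rec.
rewrite displacement0 oppr0 -scalerBl sub0r opprK.
under [X in w *: e - X]eq_bigr do rewrite scalerA.
rewrite -scaler_suml -scalerBl !enorm_sq !dote -!expr2 => <-.
congr (_ + _); apply: eq_bigr => i _; apply: eq_bigr => j _.
have XE k : oapp (fun i => - displacement H g i *: e) (- w *: e) k = X k *: e.
  by case: k.
have gE k : oapp (fun i => g i *: e) 0 k = ext g k *: e.
  by case: k => //=; rewrite scale0r.
by rewrite /Qf !XE !gE -!scalerBl enorm_sq !dote -expr2 -/F.
Qed.

Let hypS := unconstrained_scalar.

(** Function values do not split over coordinates; charging them to the coordinate [r0] makes Q^f a
    sum of scalar expressions. *)
Lemma QfE (I : Type) (f : I -> R) (g x : I -> 'cV[R]_d) i j :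
  Qf f g x i j = \sum_r (f i * (r == r0)%:R - f j * (r == r0)%:R
    - g j r 0 * (x i r 0 - x j r 0) - 2^-1 * (g i r 0 - g j r 0) ^+ 2).
Proof.
rewrite !sumrB !sum_delta -mulr_sumr /Qf enorm_sq !dotE.
congr (_ - _ - _ * _); first by apply: eq_bigr => r _; rewrite !mxE.
by apply: eq_bigr => r _; rewrite !mxE expr2.
Qed.

Lemma QhE (I : Type) (h : I -> R) (s x : I -> 'cV[R]_d) i j :
  Qh h s x i j = \sum_r (h i * (r == r0)%:R - h j * (r == r0)%:R
    - s j r 0 * (x i r 0 - x j r 0)).
Proof.
rewrite !sumrB !sum_delta /Qh dotE; congr (_ - _).
by apply: eq_bigr => r _; rewrite !mxE.
Qed.

Lemma unconstrained_composite xi : composite_identity d H lam gam Rn xi.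
Proof.
move=> f fs h hs x g xs s ss rec u V.
pose w r := (x ord0 - xs) r 0.
pose a r := oapp (fun k => s k r 0) (ss r 0).
pose G r i := g i r 0 + harmonic_ext lam gam (a r) (Some i).
have xE r i : x i r 0 = x ord0 r 0 - displacement H (G r) i.
  apply: (@displacement_eq _ _ H (G r) (fun i => x i r 0)) => k.
  rewrite rec [LHS]mxE [X in _ + X]mxE summxE; congr (_ - _).
  by apply: eq_bigr => j _; rewrite /G harmonic_cur !mxE.
pose X r := oapp (fun i => - displacement H (G r) i) (- w r).
have XE r k : oapp x xs k r 0 = x ord0 r 0 + X r k.
  case: k => [i|]; first exact: xE.
  by rewrite /X /w /= !mxE; ring.
have XB r k l : oapp x xs k r 0 - oapp x xs l r 0 = X r k - X r l.
  by rewrite !(XE r) opprD addrACA subrr add0r.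
have hgm := harmonic_max lam_ge0 lam_diag Rn_gt0 hypS.
(* The sum of the sigma_i s_i in u is gamma_n t, so u is the gamma-weighted sum of the G_i. *)
have uE r : (x ord0 - xs - u) r 0 = w r - gam_sum gam (G r).
  rewrite [LHS]mxE [X in _ + X]mxE; congr (_ - _).
  rewrite /u /gam_sum (sum_cur (fun i => gam i * G r i)) /G mulrDr hgm addrA.
  rewrite [LHS]mxE [X in X + _]mxE.
  rewrite !summxE; congr (_ + _ + _).
  - by apply: eq_bigr => i _; rewrite harmonic_cur !mxE.
  - by rewrite mxE.
  - by apply: eq_bigr => i _; rewrite mxE; case: i.
pose fr r i := f i * (r == r0)%:R.
pose hr r i := h i * (r == r0)%:R.
have tot r := scalar_composite_identity hH lam_ge0 lam_diag Rn_gt0 hypS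
  (fun i => g i r 0) (fun k => s k r 0) (ss r 0) (w r)
  (fr r) (fs * (r == r0)%:R) (hr r) (hs * (r == r0)%:R) xi.
have -> : Rn * (fs + hs - (f ord_max + h ord_max))
    + 2^-1 * (1 + xi) * enorm (x ord0 - xs) ^+ 2 =
  \sum_r (Rn * ((fs * (r == r0)%:R + hs * (r == r0)%:R)
      - (fr r ord_max + hr r ord_max)) + 2^-1 * (1 + xi) * w r ^+ 2).
  rewrite big_split -!mulr_sumr sumrB !big_split /= !sum_delta enorm_sq dotE.
  by congr (_ + _ * _); apply: eq_bigr => r _; rewrite -expr2.
under [RHS]eq_bigr do rewrite -tot.
rewrite !big_split /= -!mulr_sumr; congr (_ + _ + _ * _ + _ * _).
- rewrite [RHS]exchange_big; apply: eq_bigr => i _.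
  rewrite [RHS]exchange_big; apply: eq_bigr => j _.
  rewrite -mulr_sumr QfE; congr (_ * _).
  apply: eq_bigr => r _; rewrite XB /X /fr.
  by case: i => [i|] //=; rewrite [(- ss) r 0]mxE.
- rewrite [RHS]exchange_big; apply: eq_bigr => i _.
  rewrite [RHS]exchange_big; apply: eq_bigr => j _.
  rewrite -mulr_sumr QhE; congr (_ * _).
  apply: eq_bigr => r _; rewrite /hr.
  case: i => [i|] /=.
    by have := XB r (Some (nxt i)) (Some (nxt j)) => /= ->.
  by have := XB r None (Some (nxt j)) => /= ->.
- by rewrite enorm_sq dotE; apply: eq_bigr => r _; rewrite uE expr2.
- rewrite /mxtrace; apply: eq_bigr => r _.
  rewrite -/(a r) -star_col_dot -(Lmat_quad lam_ge0 lam_diag Rn_gt0 hypS).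
  rewrite -Smat_quad.
  have -> : col_mx (w r)%:M (star_col (a r)) = (row r V)^T.
    rewrite /V !row_row_mx !tr_row_mx /star_col; congr (col_mx _ (col_mx _ _)).
    + by apply/colP => i; rewrite !ord1 !mxE eqxx mulr1n /w !mxE.
    + by apply/colP => i; rewrite !mxE.
    + by apply/colP => i; rewrite !ord1 !mxE eqxx mulr1n.
  rewrite trmxK -row_mul [RHS]mxE [LHS]mxE; apply: eq_bigr => k _.
  by congr (_ * _); [rewrite [RHS]mxE | rewrite [LHS]mxE [RHS]mxE [RHS]mxE].
Qed.

End Lifting.

(** * Convex analysis: descent, co-coercivity and optimality *)

Section Dot.
Context {R : realType} {d : nat}.
Implicit Types u v w : 'cV[R]_d.

Lemma dotC u v : dot u v = dot v u.
Proof. by rewrite !dotE; apply: eq_bigr => r _; rewrite mulrC. Qed.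

Lemma dotDr u v w : dot u (v + w) = dot u v + dot u w.
Proof. by rewrite /dot mulmxDr mxE. Qed.

Lemma dotZr a u v : dot u (a *: v) = a * dot u v.
Proof. by rewrite /dot -scalemxAr mxE. Qed.

Lemma dotZl a u v : dot (a *: u) v = a * dot u v.
Proof. by rewrite dotC dotZr dotC. Qed.

Lemma dotBr u v w : dot u (v - w) = dot u v - dot u w.
Proof. by rewrite -scaleN1r dotDr dotZr mulN1r. Qed.

Lemma dotBl u v w : dot (u - v) w = dot u w - dot v w.
Proof. by rewrite ![dot _ w]dotC dotBr. Qed.

Lemma dotNl u v : dot (- u) v = - dot u v.
Proof. by rewrite dotC -scaleN1r dotZr dotC mulN1r. Qed.

(** In place of Cauchy-Schwarz: expand 0 <= |u - c v|^2 and bound |u|^2 by c^2 |v|^2. *)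
Lemma dot_le_of_enorm u v c : 0 < c -> enorm u <= c * enorm v ->
  dot u v <= c * dot v v.
Proof.
move=> c_gt0 le_uv.
have : enorm u ^+ 2 <= (c * enorm v) ^+ 2.
  by rewrite lerXn2r ?nnegrE ?mulr_ge0 ?sqrtr_ge0 // ltW.
rewrite exprMn !enorm_sq => le_sq.
have := dot_ge0 (u - c *: v).
rewrite dotBr dotZr !dotBl !dotZl (dotC v) => ge0.
rewrite -(ler_pM2l c_gt0); move: le_sq ge0.
by move: (dot u u) (dot u v) (dot v v) => p q r; nra.
Qed.

End Dot.

Section Gradient.
Context {R : realType} {d : nat}.
Implicit Types (f : 'cV[R]_d -> R) (x y e : 'cV[R]_d).
Implicit Types b : R.

Lemma segmentE x y (t : R) : t *: y + (1 - t) *: x = x + t *: (y - x).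
Proof. by rewrite scalerBl scalerBr scale1r addrCA. Qed.

Lemma diff_gradient f x e :
  differentiable f x -> 'd f x e = dot (gradient f x) e.
Proof.
move=> df; rewrite [in LHS](matrix_sum_delta e) linear_sum dotE.
apply: eq_bigr => i _; rewrite big_ord1 linearZ mxE mulrC.
by rewrite deriveE.
Qed.

Lemma is_derive_line f y e (t : R) : differentiable f (y + t *: e) ->
  is_derive t (1 : R) (fun t => f (y + t *: e))
    (dot (gradient f (y + t *: e)) e).
Proof.
move=> df; have cv : derivable f (y + t *: e) e := diff_derivable df.
have E : 'D_e f (y + t *: e) = dot (gradient f (y + t *: e)) e.
  by rewrite deriveE // diff_gradient.
have quotE : (fun h => h^-1 *:
    (((fun t => f (y + t *: e)) \o shift t) (h *: (1 : R)) - f (y + t *: e))) =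
  (fun h => h^-1 *: ((f \o shift (y + t *: e)) (h *: e) - f (y + t *: e))).
  apply: funext => h; congr (_ *: (f _ - _)) => /=.
  by rewrite [_ *: 1]mulr1 scalerDl addrCA.
by apply: DeriveDef; rewrite /derivable /derive quotE; [exact: cv | exact: E].
Qed.

Lemma quotient_cvg f x e : differentiable f x ->
  (fun h => h^-1 * (f (x + h *: e) - f x)) @ (0 : R)^'+
    --> dot (gradient f x) e.
Proof.
move=> df; apply: cvg_dnbhs_at_right.
have cv : derivable f x e := diff_derivable df.
rewrite -diff_gradient // -deriveE //.
have -> : (fun h => h^-1 * (f (x + h *: e) - f x)) =
  (fun h => h^-1 *: ((f \o shift x) (h *: e) - f x)).
  by apply: funext => h; congr (_ * (f _ - _)); exact: addrC.
exact: cv.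
Qed.

Lemma gradient_le f x e b : differentiable f x ->
  (forall t, 0 < t <= 1 -> f (x + t *: e) - f x <= t * b) ->
  dot (gradient f x) e <= b.
Proof.
move=> df le_b; apply: (cvgr_to_le (@quotient_cvg f x e df)).
near=> t; have t_gt0 : 0 < t by near: t; exact: nbhs_right_gt.
rewrite mulrC ler_pdivrMr // mulrC le_b // t_gt0.
by near: t; apply: nbhs_right_le; exact: ltr01.
Unshelve. all: by end_near. Qed.

Lemma gradient_ge f x e b : differentiable f x ->
  (forall t, 0 < t <= 1 -> t * b <= f (x + t *: e) - f x) ->
  b <= dot (gradient f x) e.
Proof.
move=> df ge_b; apply: (cvgr_to_ge (@quotient_cvg f x e df)).
near=> t; have t_gt0 : 0 < t by near: t; exact: nbhs_right_gt.
rewrite mulrC ler_pdivlMr // mulrC ge_b // t_gt0.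
by near: t; apply: nbhs_right_le; exact: ltr01.
Unshelve. all: by end_near. Qed.

Lemma convex_gradient f x y : convex_function [set: 'cV[R]_d] f ->
  differentiable f x -> dot (gradient f x) (y - x) <= f y - f x.
Proof.
move=> cf df; apply: gradient_le => // t /andP[t_gt0 t_le1].
have : f (t *: y + (1 - t) *: x) <= t * f y + (1 - t) * f x.
  exact: (cf (Itv01 (ltW t_gt0) t_le1) y x (in_setT _) (in_setT _)).
rewrite segmentE; lra.
Qed.

Lemma descent f y z : smooth1 f ->
  f z <= f y + dot (gradient f y) (z - y) + 2^-1 * dot (z - y) (z - y).
Proof.
move=> [df lip]; set e := z - y.
(* The claim is p(1) <= p(0). By the mean value theorem the difference is p'(c), which the Lipschitz
   bound on the gradient makes nonpositive. *)
pose p t := f (y + t *: e) - t * dot (gradient f y) e - 2^-1 * t ^+ 2 * dot e e.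
pose dp t :=
  dot (gradient f (y + t *: e)) e - dot (gradient f y) e - t * dot e e.
have p_drv (t : R) : is_derive t (1 : R) p (dp t).
  have fdrv := is_derive_line (df (y + t *: e)).
  apply: is_derive_eq.
  by rewrite /dp /GRing.scale /=; field.
have [c] := MVT ltr01 (fun t _ => p_drv t)
  (derivable_within_continuous (fun t _ => @ex_derive _ _ _ _ _ _ _ (p_drv t))).
rewrite in_itv /= => /andP[c_gt0 _]; rewrite /p /dp.
rewrite scale0r addr0 scale1r subr0 mulr1 {1 2}/e subrKC -dotBl => E.
have : dot (gradient f (y + c *: e) - gradient f y) e <= c * dot e e.
  apply: dot_le_of_enorm => //; apply: le_trans (lip _ _) _.
  rewrite addrC addKr /enorm dotZr dotZl mulrA -expr2.
  by rewrite sqrtrM ?sqr_ge0 // sqrtr_sqr gtr0_norm.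
by move: E; lra.
Qed.

(* Chain the gradient inequality at x with the descent lemma at y, both
   evaluated at y - g for g the difference of the gradients. *)
Lemma cocoercive f x y : convex_function [set: 'cV[R]_d] f -> smooth1 f ->
  0 <= f y - f x - dot (gradient f x) (y - x)
       - 2^-1 * enorm (gradient f y - gradient f x) ^+ 2.
Proof.
move=> cf sf; set g := _ - gradient f x.
have := descent y (y - g) sf; have := convex_gradient (y - g) cf (sf.1 x).
rewrite enorm_sq (_ : y - g - y = - 1 *: g); last first.
  by rewrite scaleN1r addrAC subrr sub0r.
have -> : y - g - x = (y - x) - g by rewrite addrAC.
rewrite dotBr !dotZr dotZl.
have : dot g g = dot (gradient f y) g - dot (gradient f x) g.
  by rewrite -dotBl.
by lra.
Qed.

Lemma minimizer_fin f (h : 'cV[R]_d -> \bar R) xs y :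
  (forall x, h x != -oo%E) -> minimizer (objective f h) xs ->
  h y \is a fin_num -> h xs \is a fin_num.
Proof.
move=> h_ninfty /(_ y); rewrite /objective; move: (h_ninfty xs).
by case: (h y) => [r| |] //; case: (h xs).
Qed.

(** On the segment from xs to y, minimality and convexity of h give t (h(xs) - h(y)) <= f(xs + t (y
    - xs)) - f(xs); dividing by t and letting t tend to 0 yields the subgradient inequality. *)
Lemma minimizer_subdifferential f (h : 'cV[R]_d -> \bar R) xs :
  differentiable f xs -> (forall x, h x != -oo%E) -> econvex h ->
  minimizer (objective f h) xs -> h xs \is a fin_num ->
  subdifferential h xs (- gradient f xs).
Proof.
move=> df h_ninfty ch mini hxs; split => // y.
move hyE : (h y) (h_ninfty y) => hy.
case: hy hyE => [hy| |] // hyE _; last by rewrite leey.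
rewrite -(fineK hxs) -EFinD lee_fin dotNl.
suff : fine (h xs) - hy <= dot (gradient f xs) (y - xs) by lra.
apply: gradient_ge => // t /andP[t_gt0 t_le1].
have := ch y xs t; rewrite ltW //= t_le1 => /(_ isT).
rewrite segmentE.
have := mini (xs + t *: (y - xs)); rewrite /objective.
move: (h_ninfty (xs + t *: (y - xs))).
rewrite hyE -(fineK hxs); case: (h (xs + _)) => [z| |] // _.
by rewrite -!EFinM -!EFinD !lee_fin; lra.
Qed.

End Gradient.

(** * The convergence rate *)

Lemma psd_trace_ge0 (R : realType) (d k : nat) (S : 'M[R]_k)
    (V : 'M[R]_(d, k)) :
  psd S -> 0 <= \tr (V *m S *m V^T).
Proof.
move=> [_ S_ge0]; apply: sumr_ge0 => r _; have := S_ge0 (row r V)^T.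
rewrite trmxK -row_mul [X in 0 <= X -> _]mxE [X in _ -> 0 <= X]mxE.
rewrite (eq_bigr (fun k => (V *m S) r k * V^T k r)) // => l _.
by congr (_ * _); [rewrite [LHS]mxE | rewrite [LHS]mxE [LHS]mxE [RHS]mxE].
Qed.

Section Rate.
Context {R : realType} {d m : nat}.
Local Notation n := m.+1.
Variables (H : 'M[R]_n) (lam : option 'I_n.+1 -> 'I_n.+1 -> R).
Variables (gam : 'I_n.+1 -> R) (Rn xi : R).
Hypothesis lam_ge0 : forall i j, 0 <= lam i j.
Hypothesis Rn_gt0 : 0 < Rn.
Hypothesis composite : composite_identity d H lam gam Rn xi.
Hypothesis mu_ge0 : forall i j, i != Some j -> 0 <= mu H lam gam i j.
Hypothesis S_psd : psd (Smat H lam gam xi).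

Lemma composite_rate (f : 'cV[R]_d -> R) (h : 'cV[R]_d -> \bar R) xs
    (x : 'I_n.+1 -> 'cV[R]_d) (s : 'I_n -> 'cV[R]_d) :
  convex_function [set: 'cV[R]_d] f -> smooth1 f ->
  (forall x, h x != -oo%E) -> econvex h ->
  minimizer (objective f h) xs ->
  (forall k, subdifferential h (x (nxt k)) (s k)) ->
  composite_method H x (fun i => gradient f (x i)) s ->
  (objective f h (x ord_max) - objective f h xs
    <= ((1 + xi) / (2 * Rn) * enorm (x ord0 - xs) ^+ 2)%:E)%E.
Proof.
move=> cf sf h_ninfty ch mini sub rec.
have hx k : h (x (nxt k)) \is a fin_num by case: (sub k).
have hxs := minimizer_fin h_ninfty mini (hx ord_max).
(* With this choice - s_* is the gradient of f at x_*, so the smooth terms at * are genuine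
   co-coercivities. *)
pose ss := - gradient f xs.
have sub_s : subdifferential h xs ss.
  exact: minimizer_subdifferential (sf.1 xs) h_ninfty ch mini hxs.
have := composite (fun i => f (x i)) (f xs) (fun k => fine (h (x (nxt k))))
  (fine (h xs)) xs ss rec.
rewrite opprK /=; set Sf := \sum_i _; set Sh := \sum_i _.
set P := enorm _ ^+ 2; set T := \tr _.
have Sf_ge0 : 0 <= Sf.
  apply: sumr_ge0 => i _; apply: sumr_ge0 => j _; rewrite mulr_ge0 //.
  by case: i => [i|]; exact: cocoercive.
have Sh_ge0 : 0 <= Sh.
  apply: sumr_ge0 => i _; apply: sumr_ge0 => j _.
  (* The diagonal of [mu] is 0 by definition, so the sign hypothesis off the diagonal suffices. *)
  have [->|ne_ij] := eqVneq i (Some j); first by rewrite /= eqxx mul0r.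
  rewrite mulr_ge0 ?mu_ge0 // /Qh /=.
  have [_ subj] := sub j.
  case: {ne_ij} i => [i|] /=.
    have := subj (x (nxt i)); rewrite -(fineK (hx i)) -(fineK (hx j)).
    by rewrite -EFinD lee_fin /=; lra.
  have := subj xs; rewrite -(fineK hxs) -(fineK (hx j)).
  by rewrite -EFinD lee_fin /=; lra.
have T_ge0 : 0 <= T by exact: psd_trace_ge0.
have P_ge0 : 0 <= P by exact: sqr_ge0.
have -> : x ord_max = x (nxt (ord_max : 'I_n)) by rewrite nxt_max.
rewrite /objective -(fineK hxs) -(fineK (hx ord_max)) /= => E.
rewrite -!EFinD lee_fin -(ler_pM2l Rn_gt0).
have -> : Rn * ((1 + xi) / (2 * Rn) * enorm (x ord0 - xs) ^+ 2) =
    2^-1 * (1 + xi) * enorm (x ord0 - xs) ^+ 2.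
  by field; rewrite lt0r_neq0.
by move: E; rewrite opprD; lra.
Qed.

End Rate.

Theorem theorem2p6 (R : realType) (d m : nat) (hd : (0 < d)%N)
    (H : 'M[R]_m.+1) (hH : stepsize_matrix H)
    (lam : option 'I_m.+2 -> 'I_m.+2 -> R)
    (lam_ge0 : forall i j, 0 <= lam i j)
    (lam_diag : forall j, lam (Some j) j = 0)
    (gam : 'I_m.+2 -> R) (Rn : R) (Rn_gt0 : 0 < Rn)
    (hyp : unconstrained_identity d H lam gam Rn) (xi : R) :
  [/\ composite_identity d H lam gam Rn xi,
      \sum_i vv H lam gam i = 0,
      laplacian (Lmat lam gam),
      xi = ((star_col (vv H lam gam))^T *m mp_inv (Lmat lam gam)
            *m star_col (vv H lam gam)) 0 0 ->
        psd (Smat H lam gam xi) &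
      (forall i j, i != Some j -> 0 <= mu H lam gam i j) ->
      psd (Smat H lam gam xi) ->
      forall (f : 'cV[R]_d -> R) (h : 'cV[R]_d -> \bar R),
      convex_function [set: 'cV[R]_d] f -> smooth1 f ->
      (forall x, h x != -oo%E) -> econvex h ->
      forall (xs : 'cV[R]_d), minimizer (objective f h) xs ->
      forall (x : 'I_m.+2 -> 'cV[R]_d) (s : 'I_m.+1 -> 'cV[R]_d),
      (forall k, subdifferential h (x (nxt k)) (s k)) ->
      composite_method H x (fun i => gradient f (x i)) s ->
      (objective f h (x ord_max) - objective f h xs
        <= ((1 + xi) / (2 * Rn) * enorm (x ord0 - xs) ^+ 2)%:E)%E ].
Proof.
have hypS := unconstrained_scalar hd hyp.
have composite xi' :=
  unconstrained_composite hd hH lam_ge0 lam_diag Rn_gt0 hyp xi'.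
split.
- exact: composite.
- exact: sum_vv_one hH lam_ge0 lam_diag Rn_gt0 hypS.
- exact: Lmat_laplacian lam_ge0 lam_diag Rn_gt0 hypS.
- by move=> xiE; apply: (Smat_psd hH lam_ge0 lam_diag Rn_gt0 hypS).
- move=> mu_ge0 S_psd f h cf sf h_ninfty ch xs mini x s sub rec.
  exact: (composite_rate lam_ge0 Rn_gt0 (composite xi) mu_ge0 S_psd cf sf).
Qed.
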